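(* Let $k$ be a field of characteristic zero. There is a nondegenerate dual pairing of the Hopf algebras $U_{\mathrm{CM}}$ and $\mathcal{H}_{\mathrm{CM}}$, given by $$\langle \mathbf{z}\,\xi,\ \mathbf{t}\,x\rangle:=\langle\mathbf{z},\mathbf{t}\rangle\,\langle\xi,x\rangle$$ for all $\mathbf{z}=z_{m_1}\cdots z_{m_p}\in U(\mathbf{d}_0)$, $\xi=\alpha^i\beta^j\in k[\mathrm{B}_+]$, $\mathbf{t}=t_{n_1}\cdots t_{n_A}\in k[\mathrm{D}_0]$, $x=X^rY^s\in U(\mathbf{b}_+)$, where the pairings on the right-hand side are the dual pairing of the Hopf algebras $U(\mathbf{d}_0)$ and $k[\mathrm{D}_0]$ defined on generators by $\langle z_m,t_n\rangle=\delta_{m,n}$ (Kronecker delta, $m\ge2$, $n\ge1$), and the dual pairing of $k[\mathrm{B}_+]$ with $U(\mathbf{b}_+)$ given by $\langle\alpha^i\beta^j,X^rY^s\rangle=r!\,\delta_{r,j}\,i^s$ for $i\in\mathbb{Z}$ and $j,r,s\in\mathbb{N}$ (with $0^0=1$).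
   Context: A dual pairing of Hopf algebras $\mathcal{H},\mathcal{K}$ is a bilinear form with $\langle a,xy\rangle=\sum\langle a_{(1)},x\rangle\langle a_{(2)},y\rangle$, $\langle ab,x\rangle=\sum\langle a,x_{(1)}\rangle\langle b,x_{(2)}\rangle$, $\langle Sa,x\rangle=\langle a,Sx\rangle$, $\langle a,1\rangle=\varepsilon(a)$, $\langle1,x\rangle=\varepsilon(x)$. It is nondegenerate if no nonzero element of either side pairs to zero with everything on the other side. $\mathcal{H}_{\mathrm{CM}}$ is the Hopf algebra over $k$ generated by $X,Y,\delta_n$ ($n\ge1$) with $[Y,X]=X$, $[X,\delta_n]=\delta_{n+1}$, $[Y,\delta_n]=n\delta_n$, $[\delta_m,\delta_n]=0$; $\Delta(X)=X\otimes1+1\otimes X+Y\otimes\delta_1$, $\Delta(Y)=Y\otimes1+1\otimes Y$, $\Delta(\delta_1)=\delta_1\otimes1+1\otimes\delta_1$, $\varepsilon(X)=\varepsilon(Y)=\varepsilon(\delta_n)=0$, $S(Y)=-Y$, $S(X)=Y\delta_1-X$, $S(\delta_1)=-\delta_1$, with $\Delta(\delta_{n+1}),S(\delta_{n+1})$ defined inductively from $[X,\delta_n]=\delta_{n+1}$. $k[\mathrm{D}_0]\subset\mathcal{H}_{\mathrm{CM}}$ is the commutative Hopf subalgebra generated by the $\delta_n$. It is also presented as the commutative Hopf algebra with generators $t_n$ ($n\ge1$), $t_1=1$, $\varepsilon(t_n)=\delta_{n,1}$ and $\Delta(t_n)=\sum_{k=1}^n\big(\sum_{i_1+\dots+i_k=n}t_{i_1}\cdots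 t_{i_k}\big)\otimes t_k$, the two sets of generators being related by $(n+1)t_{n+1}=\sum_{c_1+2c_2+\dots+nc_n=n}\frac{\delta_1^{c_1}\cdots\delta_n^{c_n}}{c_1!\cdots c_n!\,(1!)^{c_1}\cdots(n!)^{c_n}}$. In terms of the $t_n$, $\mathcal{H}_{\mathrm{CM}}$ has relations $[Y,X]=X$, $[X,t_n]=(n+1)t_{n+1}-2t_2t_n$, $[Y,t_n]=(n-1)t_n$, and $\Delta(X)=X\otimes1+1\otimes X+Y\otimes2t_2$. $\mathbf{b}_+$ is the Lie algebra generated by $X,Y$ with $[Y,X]=X$, and $U(\mathbf{b}_+)$ is its enveloping algebra, with $X,Y$ primitive. $\mathcal{H}_{\mathrm{CM}}$ is a bicrossproduct with underlying vector space $k[\mathrm{D}_0]\otimes U(\mathbf{b}_+)$. $\mathbf{d}_0$ is the Lie algebra with basis $\{z_n\}_{n\ge2}$, $[z_m,z_n]=(n-m)z_{m+n-1}$, and $U(\mathbf{d}_0)$ is its enveloping algebra with canonical Hopf structure ($z_n$ primitive). $k[\mathrm{B}_+]$ is the commutative Hopf algebra generated by $\alpha^{\pm1},\beta$ with $\Delta(\alpha)=\alpha\otimes\alpha$, $\Delta(\beta)=\alpha\otimes\beta+\beta\otimes1$, $\varepsilon(\alpha)=1$, $\varepsilon(\beta)=0$, $S(\alpha)=\alpha^{-1}$, $S(\beta)=-\alpha^{-1}\beta$. $U_{\mathrm{CM}}$ is the Hopf algebra generated by $z_n$ ($n\ge2$), $\alpha^{\pm1},\beta$ with $[\alpha,\beta]=0$,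 $[z_m,z_n]=(n-m)z_{m+n-1}$, $[z_n,\alpha]=-n\alpha\beta^{n-1}$, $[z_n,\beta]=\beta^n$, $\Delta(\alpha)=\alpha\otimes\alpha$, $\Delta(\beta)=\alpha\otimes\beta+\beta\otimes1$, $\Delta(z_n)=z_n\otimes1+\sum_{j=2}^n\binom nj\alpha^{j-1}\beta^{n-j}\otimes z_j$, with antipode and counit defined accordingly; it is a bicrossproduct with underlying vector space $U(\mathbf{d}_0)\otimes k[\mathrm{B}_+]$.
   Formalization: The printed U_CM is not a bialgebra (Δ would force 4αβ⊗β=0) and the printed Δ(t_n) is opposite to that of H_CM; the relations are taken as [z_m,z_n]=(m-n)z_{m+n-1}, [z_n,α]=-nαβ^{n-1}, [z_n,β]=-β^n, and Δ(t_n) is the one induced by Δ(X). *)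

(* Defs.v *)
From HB Require Import structures.
From mathcomp Require Import all_boot all_order all_algebra.
From mathcomp Require Import boolp.

Set Implicit Arguments.
Unset Strict Implicit.
Unset Printing Implicit Defensive.

Import GRing.Theory.
Local Open Scope ring_scope.
Local Open Scope quotient_scope.

(* The tensor product A (x) B of two vector spaces is the quotient of the
   finite formal sums of pairs [:: (a1, b1); ...; (an, bn)], standing for
   a1 (x) b1 + ... + an (x) bn, which identifies two sums when no bilinear map
   separates them. *)
Section Tensor.
Variables (k : fieldType) (A B : lmodType k).
Implicit Types s t : seq (A * B).

Definition tens_equiv s t : Prop :=
  forall (V : lmodType k) (f : A -> B -> V), bilinear_for *:%R *:%R f ->
  \sum_(u <- s) f u.1 u.2 = \sum_(u <- t) f u.1 u.2.

Definition tens_rel s t : bool := `[< tens_equiv s t >].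

Lemma tens_rel_refl : reflexive tens_rel.
Proof. by move=> s; apply/asboolP. Qed.

Lemma tens_rel_sym : symmetric tens_rel.
Proof.
by move=> s t; apply/asboolP/asboolP => h V f fb; rewrite (h V f fb).
Qed.

Lemma tens_rel_trans : transitive tens_rel.
Proof.
move=> t s r /asboolP st /asboolP tr; apply/asboolP => V f fb.
by rewrite (st V f fb) (tr V f fb).
Qed.

Canonical tens_equiv_rel :=
  EquivRel tens_rel tens_rel_refl tens_rel_sym tens_rel_trans.

Definition tens := {eq_quot tens_rel}.

HB.instance Definition _ := Choice.on tens.
HB.instance Definition _ := EqQuotient.on tens.

Definition tpure (a : A) (b : B) : tens := \pi_tens [:: (a, b)].

(* tens_sum f x is Sweedler's sum of the f a b over x = sum a (x) b; it does
   not depend on the representing sum as soon as f is bilinear (tens_sum_pi). *)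
Definition tens_sum (V : nmodType) (f : A -> B -> V) (x : tens) : V :=
  \sum_(u <- repr x) f u.1 u.2.

Lemma tens_sum_pi (V : lmodType k) (f : A -> B -> V) s :
  bilinear_for *:%R *:%R f ->
  tens_sum f (\pi_tens s) = \sum_(u <- s) f u.1 u.2.
Proof.
by move=> fb; have /eqmodP/asboolP := reprK (\pi_tens s); apply.
Qed.

Lemma tens_piP s t : tens_equiv s t -> \pi_tens s = \pi_tens t.
Proof. by move=> st; apply/eqmodP/asboolP. Qed.

Definition tscale_seq (c : k) s := [seq (c *: u.1, u.2) | u <- s].

Lemma sum_tscale_seq (V : lmodType k) (f : A -> B -> V) c s :
  bilinear_for *:%R *:%R f ->
  \sum_(u <- tscale_seq c s) f u.1 u.2 = c *: \sum_(u <- s) f u.1 u.2.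
Proof.
case=> fl fr; rewrite big_map scaler_sumr; apply: eq_bigr => u _ /=.
by have := scalable_linear (fl u.2) c u.1; rewrite /applyr.
Qed.

Definition tadd (x y : tens) : tens := \pi_tens (repr x ++ repr y).
Definition tscale (c : k) (x : tens) : tens := \pi_tens (tscale_seq c (repr x)).

Lemma tens_ext (x y : tens) :
  (forall (V : lmodType k) (f : A -> B -> V), bilinear_for *:%R *:%R f ->
     tens_sum f x = tens_sum f y) -> x = y.
Proof.
by move=> h; rewrite -[x]reprK -[y]reprK; apply: tens_piP => V f /h.
Qed.

Section Sum.
Variables (V : lmodType k) (f : A -> B -> V).
Hypothesis fb : bilinear_for *:%R *:%R f.

Lemma tens_sum_add x y : tens_sum f (tadd x y) = tens_sum f x + tens_sum f y.
Proof. by rewrite tens_sum_pi // big_cat. Qed.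

Lemma tens_sum_scale c x : tens_sum f (tscale c x) = c *: tens_sum f x.
Proof. by rewrite tens_sum_pi // sum_tscale_seq. Qed.

Lemma tens_sum_nil : tens_sum f (\pi_tens [::]) = 0.
Proof. by rewrite tens_sum_pi // big_nil. Qed.
End Sum.

Fact taddA : associative tadd.
Proof. by move=> x y z; apply: tens_ext => V f fb; rewrite !tens_sum_add // addrA. Qed.
Fact taddC : commutative tadd.
Proof. by move=> x y; apply: tens_ext => V f fb; rewrite !tens_sum_add // addrC. Qed.
Fact tadd0 : left_id (\pi_tens [::]) tadd.
Proof.
by move=> x; apply: tens_ext => V f fb; rewrite tens_sum_add // tens_sum_nil // add0r.
Qed.
Fact taddN : left_inverse (\pi_tens [::]) (tscale (-1)) tadd.
Proof.
move=> x; apply: tens_ext => V f fb.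
by rewrite tens_sum_add // tens_sum_nil // tens_sum_scale // scaleN1r addNr.
Qed.

HB.instance Definition _ := GRing.isZmodule.Build tens taddA taddC tadd0 taddN.

Fact tscaleA c d x : tscale c (tscale d x) = tscale (c * d) x.
Proof. by apply: tens_ext => V f fb; rewrite !tens_sum_scale // scalerA. Qed.
Fact tscale1 : left_id 1 tscale.
Proof. by move=> x; apply: tens_ext => V f fb; rewrite tens_sum_scale // scale1r. Qed.
Fact tscaleDr : right_distributive tscale +%R.
Proof.
move=> c x y; apply: tens_ext => V f fb.
by rewrite tens_sum_add // !tens_sum_scale // tens_sum_add // scalerDr.
Qed.
Fact tscaleDl x : {morph tscale^~ x : c d / c + d}.
Proof.
move=> c d; apply: tens_ext => V f fb.
by rewrite tens_sum_add // !tens_sum_scale // scalerDl.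
Qed.

HB.instance Definition _ :=
  GRing.Zmodule_isLmodule.Build k tens tscaleA tscale1 tscaleDr tscaleDl.

Lemma tens_sum_is_linear (V : lmodType k) (f : A -> B -> V) :
  bilinear_for *:%R *:%R f -> linear (tens_sum f).
Proof. by move=> fb c x y; rewrite tens_sum_add // tens_sum_scale. Qed.

Lemma tens_sum_pure (V : lmodType k) (f : A -> B -> V) a b :
  bilinear_for *:%R *:%R f -> tens_sum f (tpure a b) = f a b.
Proof. by move=> fb; rewrite tens_sum_pi // big_seq1. Qed.

Lemma tpure_bilinear : bilinear_for *:%R *:%R tpure.
Proof.
split=> [b c a a'|a c b b']; apply: tens_ext => V f fb.
  rewrite tens_sum_is_linear // !tens_sum_pure //; exact: (fb.1 b c a a').
rewrite tens_sum_is_linear // !tens_sum_pure //; exact: (fb.2 a c b b').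
Qed.

Lemma tens_sumE x : x = tens_sum tpure x.
Proof.
apply: tens_ext => V f fb.
pose g : {linear tens -> V} := HB.pack (tens_sum f)
  (GRing.isLinear.Build _ _ _ _ _ (tens_sum_is_linear fb)).
rewrite -[RHS]/(g _) /tens_sum linear_sum /=.
by apply: eq_bigr => u _; rewrite tens_sum_pure.
Qed.

End Tensor.

Notation "a ⊗ b" := (tpure a b) (at level 40, left associativity) : ring_scope.

Section TensorAlgebra.
Variables (k : fieldType) (A B : algType k).
Implicit Types x y z : tens A B.

Definition tmul x y : tens A B :=
  tens_sum (fun a b => tens_sum (fun a' b' => (a * a') ⊗ (b * b')) y) x.

Lemma mul_bilinear_l (V : lmodType k) (f : A -> B -> V) a b :
  bilinear_for *:%R *:%R f ->
  bilinear_for *:%R *:%R (fun a' b' => f (a * a') (b * b')).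
Proof.
case=> fl fr; split=> [b' c u v|a' c u v]; rewrite /applyr /= mulrDr -scalerAr.
  exact: (fl (b * b') c (a * u) (a * v)).
exact: (fr (a * a') c (b * u) (b * v)).
Qed.

Lemma mul_bilinear_r (V : lmodType k) (f : A -> B -> V) a' b' :
  bilinear_for *:%R *:%R f ->
  bilinear_for *:%R *:%R (fun a b => f (a * a') (b * b')).
Proof.
case=> fl fr; split=> [b c u v|a c u v]; rewrite /applyr /= mulrDl -scalerAl.
  exact: (fl (b * b') c (u * a') (v * a')).
exact: (fr (a * a') c (u * b') (v * b')).
Qed.

Lemma sum_bilinear (V : lmodType k) (f : A -> B -> A -> B -> V) y :
  (forall a' b', bilinear_for *:%R *:%R (fun a b => f a b a' b')) ->
  bilinear_for *:%R *:%R (fun a b => tens_sum (f a b) y).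
Proof.
move=> fb; split=> [b c u v|a c u v]; rewrite /applyr /tens_sum /=;
  rewrite scaler_sumr -big_split; apply: eq_bigr => w _ /=.
  exact: ((fb w.1 w.2).1 b c u v).
exact: ((fb w.1 w.2).2 a c u v).
Qed.

Lemma tens_sum_sum (V : lmodType k) (f : A -> B -> V)
    (g : A -> B -> tens A B) x :
  bilinear_for *:%R *:%R f ->
  tens_sum f (tens_sum g x) = tens_sum (fun a b => tens_sum f (g a b)) x.
Proof.
move=> fb; pose h : {linear tens A B -> V} := HB.pack (tens_sum f)
  (GRing.isLinear.Build _ _ _ _ _ (tens_sum_is_linear fb)).
by rewrite -[LHS]/(h _) {1}/tens_sum linear_sum.
Qed.

Lemma tens_sum_mul (V : lmodType k) (f : A -> B -> V) x y :
  bilinear_for *:%R *:%R f -> tens_sum f (tmul x y) =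
  tens_sum (fun a b => tens_sum (fun a' b' => f (a * a') (b * b')) y) x.
Proof.
move=> fb; rewrite tens_sum_sum //; apply: eq_bigr => u _.
by rewrite tens_sum_sum //; apply: eq_bigr => v _; rewrite tens_sum_pure.
Qed.

Lemma mul_sum_bilinear (V : lmodType k) (f : A -> B -> V) y :
  bilinear_for *:%R *:%R f -> bilinear_for *:%R *:%R
    (fun a b => tens_sum (fun a' b' => f (a * a') (b * b')) y).
Proof. by move=> fb; apply: sum_bilinear => a' b'; apply: mul_bilinear_r. Qed.

Fact tmulA : associative tmul.
Proof.
move=> x y z; apply: tens_ext => V f fb; rewrite !tens_sum_mul //; last first.
  exact: mul_sum_bilinear.
apply: eq_bigr => u _; rewrite tens_sum_mul; last exact: mul_bilinear_l.
by do 2!apply: eq_bigr => ? _; rewrite !mulrA.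
Qed.

Fact tmul1 : left_id (1 ⊗ 1) tmul.
Proof.
move=> x; apply: tens_ext => V f fb; rewrite tens_sum_mul // tens_sum_pure.
  by apply: eq_bigr => u _; rewrite !mul1r.
exact: mul_sum_bilinear.
Qed.

Fact tmulr1 : right_id (1 ⊗ 1) tmul.
Proof.
move=> x; apply: tens_ext => V f fb; rewrite tens_sum_mul //.
apply: eq_bigr => u _; rewrite tens_sum_pure ?mulr1 //.
exact: mul_bilinear_l.
Qed.

Fact tmulDl : left_distributive tmul +%R.
Proof.
move=> x y z; apply: tens_ext => V f fb.
have fbz := mul_sum_bilinear z fb.
rewrite tens_sum_mul // (tens_sum_add fbz) [RHS](tens_sum_add fb).
by rewrite !tens_sum_mul.
Qed.

Fact tmulDr : right_distributive tmul +%R.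
Proof.
move=> x y z; apply: tens_ext => V f fb.
rewrite tens_sum_mul // [RHS](tens_sum_add fb) !tens_sum_mul // -big_split.
by apply: eq_bigr => u _; apply: tens_sum_add; apply: mul_bilinear_l.
Qed.

HB.instance Definition _ := GRing.Zmodule_isPzRing.Build (tens A B)
  tmulA tmul1 tmulr1 tmulDl tmulDr.

Lemma tpureM a b a' b' : (a ⊗ b) * (a' ⊗ b') = (a * a') ⊗ (b * b') :> tens A B.
Proof.
apply: tens_ext => V f fb; rewrite tens_sum_mul // !tens_sum_pure //.
  exact: mul_bilinear_l.
exact: mul_sum_bilinear.
Qed.

End TensorAlgebra.

Record hopfAlg (k : fieldType) := HopfAlg {
  hopf_sort :> algType k;
  comul : {linear hopf_sort -> tens hopf_sort hopf_sort};
  counit : {lrmorphism hopf_sort -> k^o};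
  antipode : {linear hopf_sort -> hopf_sort};
  comul1 : comul 1 = 1 ⊗ 1;
  comulM : {morph comul : a b / a * b};
  comulA : forall a,
    tens_sum (fun b c => tens_sum (fun b1 b2 => b1 ⊗ (b2 ⊗ c)) (comul b))
             (comul a) =
    tens_sum (fun b c => b ⊗ comul c) (comul a);
  counitl : forall a, tens_sum (fun b c => counit b *: c) (comul a) = a;
  counitr : forall a, tens_sum (fun b c => counit c *: b) (comul a) = a;
  antipodel : forall a,
    tens_sum (fun b c => antipode b * c) (comul a) = (counit a)%:A;
  antipoder : forall a,
    tens_sum (fun b c => b * antipode c) (comul a) = (counit a)%:A
}.

Arguments comul {k h}.
Arguments counit {k h}.
Arguments antipode {k h}.

Section Pairing.
Variables (k : fieldType) (H K : hopfAlg k).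

Definition dual_pairing (p : {bilinear H -> K -> k | *%R & *%R}) : Prop :=
  [/\ forall (a : H) (x y : K),
        p a (x * y) = tens_sum (fun a1 a2 => p a1 x * p a2 y) (comul a),
      forall (a b : H) (x : K),
        p (a * b) x = tens_sum (fun x1 x2 => p a x1 * p b x2) (comul x),
      forall (a : H) (x : K), p (antipode a) x = p a (antipode x),
      forall a : H, p a 1 = counit a
    & forall x : K, p 1 x = counit x].

Definition nondegenerate_pairing (p : {bilinear H -> K -> k | *%R & *%R}) :=
  (forall a, (forall x, p a x = 0) -> a = 0) /\
  (forall x, (forall a, p a x = 0) -> x = 0).

End Pairing.

Section Presentation.
Variable k : fieldType.

Definition generates (I : Type) (A : algType k) (g : I -> A) : Prop :=
  forall S : {pred A}, GRing.subalg_closed S -> (forall i, g i \in S) ->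
  forall x, x \in S.

(* A is the algebra generated by the family g with (only) the relations rel:
   it is generated by g, g satisfies rel, and any family satisfying rel in
   another algebra is the image of g under an algebra morphism. *)
Definition presented (I : Type) (rel : forall A : algType k, (I -> A) -> Prop)
    (A : algType k) (g : I -> A) : Prop :=
  [/\ rel A g, generates g
    & forall (B : algType k) (h : I -> B), rel B h ->
      exists f : {lrmorphism A -> B}, forall i, f (g i) = h i].

Definition bracket (A : algType k) (x y : A) : A := x * y - y * x.

Definition primitive (H : hopfAlg k) (x : H) : Prop :=
  comul x = x ⊗ 1 + 1 ⊗ x.

(* a ^ i for i : int, given a and its inverse a' *)
Definition zpow (A : algType k) (a a' : A) (i : int) : A :=
  match i with Posz n => a ^+ n | Negz n => a' ^+ n.+1 end.

End Presentation.

Notation "⁅ x , y ⁆" := (bracket x y) : ring_scope.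

(* The families delta_n (n >= 1) and z_n (n >= 2) are indexed by nat so as to
   keep their usual numbering; the unused delta_0, z_0 and z_1 are set to 0. *)
Section ConnesMoscovici.
Variable k : fieldType.

Variant HCM_gen := HCM_X | HCM_Y | HCM_delta of nat.

Definition HCM_rel (A : algType k) (g : HCM_gen -> A) : Prop :=
  let X := g HCM_X in let Y := g HCM_Y in let d n := g (HCM_delta n) in
  [/\ d 0 = 0,
      ⁅Y, X⁆ = X,
      forall n, (1 <= n)%N -> ⁅X, d n⁆ = d n.+1,
      forall n, (1 <= n)%N -> ⁅Y, d n⁆ = n%:R *: d n
    & forall m n, (1 <= m)%N -> (1 <= n)%N -> ⁅d m, d n⁆ = 0].

(* On delta_{n+1} = [X, delta_n] the structure maps are determined by
   multiplicativity (antimultiplicativity for the antipode). *)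
Definition is_HCM (H : hopfAlg k) (g : HCM_gen -> H) : Prop :=
  let X := g HCM_X in let Y := g HCM_Y in let d n := g (HCM_delta n) in
  [/\ presented HCM_rel g,
      [/\ comul X = X ⊗ 1 + 1 ⊗ X + Y ⊗ d 1, primitive Y & primitive (d 1)],
      [/\ counit X = 0, counit Y = 0 & forall n, counit (d n) = 0]
    & [/\ antipode Y = - Y, antipode X = Y * d 1 - X
        & antipode (d 1) = - d 1]].

(* D, embedded by i, is the Hopf subalgebra of H generated by the delta_n. *)
Definition is_kD0 (H : hopfAlg k) (g : HCM_gen -> H) (D : hopfAlg k)
    (d : nat -> D) (i : {lrmorphism D -> H}) : Prop :=
  [/\ injective i,
      forall n, i (d n) = g (HCM_delta n),
      generates d
    & forall a : D,
      [/\ comul (i a) = tens_sum (fun b c => i b ⊗ i c) (comul a),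
          counit (i a) = counit a & antipode (i a) = i (antipode a)]].

(* n t_n is the sum over c_1 + 2 c_2 + ... + (n-1) c_{n-1} = n-1 of
   prod_j delta_j^{c_j} / (c_j! (j!)^{c_j}); the index j : 'I_m below stands
   for j+1. *)
Definition t_of (A : algType k) (d : nat -> A) (n : nat) : A :=
  if n is m.+1 then
    (n%:R : k)^-1 *:
    \sum_(c : {ffun 'I_m -> 'I_m.+1} | (\sum_(j < m) j.+1 * c j)%N == m)
      (\prod_(j < m) ((c j)`! * (j.+1)`! ^ c j)%N%:R : k)^-1 *:
      \prod_(j < m) d j.+1 ^+ c j
  else 0.

Variant bp_gen := bp_X | bp_Y.

Definition Ubp_rel (A : algType k) (g : bp_gen -> A) : Prop :=
  ⁅g bp_Y, g bp_X⁆ = g bp_X.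

Definition is_Ubp (H : hopfAlg k) (g : bp_gen -> H) : Prop :=
  presented Ubp_rel g /\ forall i, primitive (g i).

(* Sign conventions in Ud0_rel and UCM_rel.  In the Hopf algebra given by
   HCM_rel and is_HCM, Delta(t_N) contains m t_m (x) t_n whenever m+n-1 = N
   and m, n >= 2 (from Delta(X) = X (x) 1 + 1 (x) X + Y (x) delta_1), so a
   pairing with <z_m, t_n> = delta_{m,n} has <z_m z_n, t_N> = m; likewise
   <alpha z_n - z_n alpha, X^(n-1)> = n! and
   <beta z_n - z_n beta, X^n> = n!.  This forces the three signs below.  The
   other usual convention, [z_m, z_n] = (n - m) z_{m+n-1},
   [z_n, alpha] = n alpha beta^(n-1), [z_n, beta] = beta^n, is obtained by
   replacing each z_n by - z_n, with the same coproduct on the z_n. *)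
Definition Ud0_rel (A : algType k) (z : nat -> A) : Prop :=
  [/\ z 0 = 0, z 1 = 0
    & forall m n, (2 <= m)%N -> (2 <= n)%N ->
      ⁅z m, z n⁆ = (m%:R - n%:R) *: z (m + n).-1].

Definition is_Ud0 (H : hopfAlg k) (z : nat -> H) : Prop :=
  presented Ud0_rel z /\ forall n, (2 <= n)%N -> primitive (z n).

Variant kBp_gen := kBp_alpha | kBp_alphaV | kBp_beta.

Definition kBp_rel (A : algType k) (g : kBp_gen -> A) : Prop :=
  let a := g kBp_alpha in let a' := g kBp_alphaV in let b := g kBp_beta in
  [/\ a * a' = 1, a' * a = 1 & ⁅a, b⁆ = 0].

Definition is_kBp (H : hopfAlg k) (g : kBp_gen -> H) : Prop :=
  let a := g kBp_alpha in let a' := g kBp_alphaV in let b := g kBp_beta in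
  [/\ presented kBp_rel g,
      comul a = a ⊗ a /\ comul b = a ⊗ b + b ⊗ 1,
      counit a = 1 /\ counit b = 0
    & antipode a = a' /\ antipode b = - (a' * b)].

Variant UCM_gen := UCM_z of nat | UCM_alpha | UCM_alphaV | UCM_beta.

Definition UCM_rel (A : algType k) (g : UCM_gen -> A) : Prop :=
  let z n := g (UCM_z n) in
  let a := g UCM_alpha in let a' := g UCM_alphaV in let b := g UCM_beta in
  [/\ Ud0_rel z,
      [/\ a * a' = 1, a' * a = 1 & ⁅a, b⁆ = 0],
      forall n, (2 <= n)%N -> ⁅z n, a⁆ = - (n%:R *: (a * b ^+ n.-1))
    & forall n, (2 <= n)%N -> ⁅z n, b⁆ = - b ^+ n].

(* The counit and the antipode are determined by the coproduct. *)
Definition is_UCM (H : hopfAlg k) (g : UCM_gen -> H) : Prop :=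
  let z n := g (UCM_z n) in let a := g UCM_alpha in let b := g UCM_beta in
  [/\ presented UCM_rel g,
      comul a = a ⊗ a,
      comul b = a ⊗ b + b ⊗ 1
    & forall n, (2 <= n)%N -> comul (z n) =
        z n ⊗ 1 + \sum_(2 <= j < n.+1)
          'C(n, j)%:R *: ((a ^+ j.-1 * b ^+ (n - j)) ⊗ z j)].

End ConnesMoscovici.

(* Main.v *)
(* The functionals X, Y and delta_1 on U_CM are the entries of a representation
   by upper triangular 3 x 3 matrices, in which the coproduct of X becomes a
   matrix product. In the convolution algebra dual to U_CM they generate an
   image of H_CM: brackets of functionals which are derivations along the counit
   are again such derivations, so they only need to be compared on generators,
   and the delta_n commute because they are bi-invariant under k[B_+], i.e. they
   live on the quotient of U_CM isomorphic to the cocommutative U(d_0). The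
   pairing of U_CM with H_CM is this algebra morphism; the compatibility with
   the product of U_CM is checked on the generators of H_CM, and the antipode
   axiom follows from the uniqueness of convolution inverses.

   The two other pairings are obtained by restriction. The pairing of z xi with
   t x is the value at z xi of the product of t, right invariant under k[B_+],
   by x, left invariant under U(d_0), and so it factors. Finally the words in
   the z_n times k[B_+] and the words in the delta_n times U(b_+) span both
   algebras, and the pairing of these words is triangular for their length, with
   a diagonal block which is nonzero exactly on pairs of permuted words; so no
   linear independence of these spanning families needs to be known. *)
Require Import Defs.
From HB Require Import structures.
From mathcomp Require Import all_boot all_order all_algebra.
From mathcomp Require Import boolp functions ring zify.

Set Implicit Arguments.
Unset Strict Implicit.
Unset Printing Implicit Defensive.

Import GRing.Theory.
Local Open Scope ring_scope.

(** * The convolution algebra of linear functionals *)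

(** Five of the Hopf algebras are known only by generators and relations, and [k[D_0]] only by its
    embedding, so what can be constructed freely are algebra morphisms out of the presented ones.
    Hence functionals on U_CM must be read off a representation of it, and the pairing of [U(d_0)]
    with [k[D_0]], which has no presentation to start from, must pass through U_CM and H_CM. There
    the obstacle is that [z_n] is primitive in [U(d_0)] but not in U_CM: restricting functionals to
    [U(d_0)] respects products only for those invariant under [k[B_+]]. The full linear dual is an
    algebra but carries no coproduct with values in the algebraic tensor square, so the coproduct of
    a functional is a relation, [cop], between a functional and a tensor. The constant 2 attached to
    [z_2] in the representation is forced by [delta_1 = 2 t_2]. Characteristic zero enters in
    dividing by [n] to define [t_n], in keeping distinct integer exponents distinct in [k], and in
    inverting the factorials on the diagonal of the pairings. *)

Lemma linear_tens_sum (k : fieldType) (A B V W : lmodType k)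
    (L : {linear V -> W}) (f : A -> B -> V) (x : tens A B) :
  L (tens_sum f x) = tens_sum (fun a b => L (f a b)) x.
Proof. exact: linear_sum. Qed.

Lemma eq_tens_sum (k : fieldType) (A B : lmodType k) (V : nmodType)
    (f g : A -> B -> V) (x : tens A B) :
  (forall a b, f a b = g a b) -> tens_sum f x = tens_sum g x.
Proof. by move=> fg; apply: eq_bigr => u _; rewrite fg. Qed.

Section Evaluation.
Variables (k : fieldType) (A B : lmodType k).

Lemma mul_bilinear (f : {linear A -> k^o}) (g : {linear B -> k^o}) :
  bilinear_for *:%R *:%R (fun a b => f a * g b : k^o).
Proof.
by split=> [b|a] c x y; rewrite /applyr /= linearP ?mulrDl ?mulrDr;
  [rewrite -scalerAl | rewrite -scalerAr].
Qed.

Definition tev (f : {linear A -> k^o}) (g : {linear B -> k^o}) (t : tens A B) :=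
  tens_sum (fun a b => f a * g b : k^o) t.

Variables (f : {linear A -> k^o}) (g : {linear B -> k^o}).

Fact tev_linear : linear (tev f g).
Proof. exact/tens_sum_is_linear/mul_bilinear. Qed.

HB.instance Definition _ :=
  GRing.isLinear.Build k (tens A B) k^o _ (tev f g) tev_linear.

Lemma tev_pure a b : tev f g (a ⊗ b) = f a * g b.
Proof. exact/tens_sum_pure/mul_bilinear. Qed.

End Evaluation.


Section Dual.
Variables (k : fieldType) (H : hopfAlg k).

(** Cutting the functionals out of all functions by a boolean predicate lets the vector space
    structure be inherited by subtyping, with pointwise equality. *)
Definition is_functional : {pred H -> k^o} := fun f => `[< linear f >].

Fact is_functional_submod : submod_closed is_functional.
Proof.
split=> [|c f g /asboolP fl /asboolP gl]; apply/asboolP => d x y.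
  by rewrite /= scaler0 addr0.
rewrite /= -[LHS]/(c *: f (d *: x + y) + g (d *: x + y)) fl gl.
by rewrite !scalerDr addrACA !scalerA [c * d]mulrC.
Qed.

HB.instance Definition _ :=
  GRing.isSubmodClosed.Build k (H -> k^o) is_functional is_functional_submod.

Record dual := Dual { dual_fun :> H -> k^o; dualP : dual_fun \in is_functional }.

HB.instance Definition _ := [isSub for dual_fun].
HB.instance Definition _ := [Choice of dual by <:].
HB.instance Definition _ := [SubChoice_isSubLmodule of dual by <:].

HB.instance Definition _ (f : dual) :=
  GRing.isLinear.Build k H k^o _ (dual_fun f) (asboolW (dualP f)).

Coercion dual_linear (f : dual) : {linear H -> k^o} := dual_fun f.

Lemma dualext (f g : dual) : f =1 g -> f = g.
Proof. by move=> fg; apply/val_inj/funext. Qed.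

Definition mkdual (f : {linear H -> k^o}) : dual :=
  Dual (asboolT (linearP f) : (f : H -> k^o) \in is_functional).

Lemma mkdualE f x : mkdual f x = f x. Proof. by []. Qed.

Lemma dual0E x : (0 : dual) x = 0. Proof. by []. Qed.
Lemma dualDE (f g : dual) x : (f + g) x = f x + g x. Proof. by []. Qed.
Lemma dualZE c (f : dual) x : (c *: f) x = c * f x. Proof. by []. Qed.
Lemma dualNE (f : dual) x : (- f) x = - f x. Proof. by []. Qed.

Definition dual_mul (f g : dual) : dual := mkdual (tev f g \o comul).
Definition dual_one : dual := mkdual counit.


Lemma dual_mulE f g x : dual_mul f g x = tens_sum (fun a b => f a * g b : k^o) (comul x).
Proof. by []. Qed.

Fact dual_mulA : associative dual_mul.
Proof.
move=> f g h; apply: dualext => x; rewrite !dual_mulE.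
have := congr1 (tev f (tev g h)) (comulA x); rewrite !linear_tens_sum /= => E.
transitivity (tens_sum (fun a b => tev f (tev g h) (a ⊗ comul b) : k^o) (comul x)).
  by apply: eq_tens_sum => b c; rewrite tev_pure.
rewrite -E; apply: eq_tens_sum => b c.
rewrite linear_tens_sum [in RHS]/tev /tens_sum mulr_suml.
by apply: eq_bigr => u _; rewrite /= tev_pure /= tev_pure mulrA.
Qed.

Fact dual_mul1 : left_id dual_one dual_mul.
Proof.
move=> f; apply: dualext => x; rewrite dual_mulE -[in RHS](counitl x).
by rewrite linear_tens_sum; apply: eq_tens_sum => a b; rewrite linearZ.
Qed.

Fact dual_mulr1 : right_id dual_one dual_mul.
Proof.
move=> f; apply: dualext => x; rewrite dual_mulE -[in RHS](counitr x).
by rewrite linear_tens_sum; apply: eq_tens_sum => a b; rewrite linearZ /= mulrC.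
Qed.

Fact dual_mulDl : left_distributive dual_mul +%R.
Proof.
move=> f g h; apply: dualext => x; rewrite dualDE !dual_mulE -big_split.
by apply: eq_bigr => u _; apply: mulrDl.
Qed.

Fact dual_mulDr : right_distributive dual_mul +%R.
Proof.
move=> f g h; apply: dualext => x; rewrite dualDE !dual_mulE -big_split.
by apply: eq_bigr => u _; apply: mulrDr.
Qed.

Fact dual_one_neq0 : dual_one != 0.
Proof.
apply/eqP => /(congr1 (fun f : dual => f 1)) /eqP.
by rewrite mkdualE rmorph1 dual0E oner_eq0.
Qed.

HB.instance Definition _ := GRing.Zmodule_isNzRing.Build dual
  dual_mulA dual_mul1 dual_mulr1 dual_mulDl dual_mulDr dual_one_neq0.

Lemma dualME (f g : dual) x : (f * g) x = tev f g (comul x).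
Proof. by []. Qed.

Lemma dual1E x : (1 : dual) x = counit x. Proof. by []. Qed.

Fact dscalerAl (c : k) (f g : dual) : c *: (f * g) = (c *: f) * g.
Proof.
apply: dualext => x; rewrite dualZE !dualME [RHS]/tev /tens_sum mulr_sumr.
by apply: eq_bigr => u _; apply: mulrA.
Qed.

HB.instance Definition _ := GRing.Lmodule_isLalgebra.Build k dual dscalerAl.

Fact dscalerAr (c : k) (f g : dual) : c *: (f * g) = f * (c *: g).
Proof.
apply: dualext => x; rewrite dualZE !dualME [RHS]/tev /tens_sum mulr_sumr.
by apply: eq_bigr => u _; apply: mulrCA.
Qed.

HB.instance Definition _ := GRing.Lalgebra_isAlgebra.Build k dual dscalerAr.

End Dual.

Arguments dual_fun : simpl never.
Arguments mkdual : simpl never.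
Arguments dual_mul : simpl never.

(** * Induction along a generating family *)

Section Generation.
Variables (k : fieldType) (I : Type) (A : algType k) (g : I -> A).
Hypothesis gen_g : generates g.

Lemma generates_ind (P : A -> Prop) :
  P 1 -> (forall c a b, P a -> P b -> P (c *: a + b)) ->
  (forall a b, P a -> P b -> P (a * b)) -> (forall i, P (g i)) ->
  forall a, P a.
Proof.
move=> P1 PL PM Pg a; pose S : {pred A} := fun a => `[< P a >].
suff : a \in S by move/asboolP.
apply: gen_g => [|i]; last exact/asboolP.
split=> [|c b d /asboolP Pb /asboolP Pd|b d /asboolP Pb /asboolP Pd].
- exact/asboolP.
- exact/asboolP/PL.
- exact/asboolP/PM.
Qed.

(** Words grow on the left, so one letter at a time is enough. This suits properties of [f a] for
    all [f] in a class stable under left translation, because [f (g i * a)] is the value at [a] of a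
    translate of [f]. *)
Lemma generates_ind_mul (P : A -> Prop) :
  P 1 -> (forall c a b, P a -> P b -> P (c *: a + b)) ->
  (forall i a, P a -> P (g i * a)) -> forall a, P a.
Proof.
move=> P1 PL Pg a; suff : forall b, P b -> P (a * b).
  by move/(_ 1 P1); rewrite mulr1.
elim/generates_ind: a => [b|c a b IHa IHb d Pd|a b IHa IHb c Pc|i b /Pg //].
- by rewrite mul1r.
- by rewrite mulrDl -scalerAl; apply: PL; [apply: IHa | apply: IHb].
- by rewrite -mulrA; apply/IHa/IHb.
Qed.

End Generation.

(** This is the reordering behind the bialgebra axiom: [r] and [s] stand for the terms of two
    coproducts, [p] and [q] for those of two tensors of functionals. *)
Lemma exchange_big4 (R : comPzRingType) (I J K L : Type) (r : seq I) (s : seq J)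
    (p : seq K) (q : seq L) (F : K -> I -> R) (G : K -> J -> R)
    (F' : L -> I -> R) (G' : L -> J -> R) :
  \sum_(u <- r) \sum_(v <- s)
     (\sum_(t <- p) F t u * G t v) * (\sum_(t <- q) F' t u * G' t v) =
  \sum_(t <- p) \sum_(t' <- q)
     (\sum_(u <- r) F t u * F' t' u) * (\sum_(v <- s) G t v * G' t' v).
Proof.
have -> : \sum_(t <- p) \sum_(t' <- q)
     (\sum_(u <- r) F t u * F' t' u) * (\sum_(v <- s) G t v * G' t' v) =
   \sum_(t <- p) \sum_(t' <- q) \sum_(u <- r) \sum_(v <- s)
     (F t u * F' t' u) * (G t v * G' t' v).
  by do 2!apply: eq_bigr => ? _; rewrite big_distrlr.
under [RHS]eq_bigr do rewrite exchange_big /=.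
rewrite [RHS]exchange_big /=; apply: eq_bigr => u _.
under [RHS]eq_bigr do rewrite exchange_big /=.
rewrite [RHS]exchange_big /=; apply: eq_bigr => v _.
by rewrite big_distrlr; do 2!apply: eq_bigr => ? _; rewrite mulrACA.
Qed.

(** * The transpose of the product on functionals *)

Section Coproduct.
Variables (k : fieldType) (H : hopfAlg k).
Implicit Types (a b : H) (f g : dual H) (T : tens (dual H) (dual H)).

Definition dual_eval a f : k^o := f a.

Fact dual_eval_linear a : linear (dual_eval a). Proof. by []. Qed.

HB.instance Definition _ a :=
  GRing.isLinear.Build k (dual H) k^o _ (dual_eval a) (dual_eval_linear a).

(* The transpose of the product of [H] maps [f] to [T]. *)
Definition cop f T := forall a b,
  f (a * b) = tev (dual_eval a) (dual_eval b) T.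

Lemma copM f g T T' : cop f T -> cop g T' -> cop (f * g) (T * T').
Proof.
move=> fT gT a b; rewrite dualME comulM.
rewrite /tev [LHS]tens_sum_mul; last exact: mul_bilinear.
rewrite [RHS]tens_sum_mul; last exact: mul_bilinear.
rewrite -[RHS]exchange_big4.
apply: eq_bigr => u _; apply: eq_bigr => v _.
by congr (_ * _); [apply: fT | apply: gT].
Qed.

Lemma copL c f g T T' : cop f T -> cop g T' -> cop (c *: f + g) (c *: T + T').
Proof. by move=> fT gT a b; rewrite linearP /= -fT -gT. Qed.

Lemma copB f g T T' : cop f T -> cop g T' -> cop (f - g) (T - T').
Proof. by move=> fT gT a b; rewrite linearB /= -fT -gT. Qed.

Lemma cop_bracket f g T T' : cop f T -> cop g T' -> cop ⁅f, g⁆ (T * T' - T' * T).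
Proof. by move=> fT gT; apply: copB; apply: copM. Qed.

Lemma cop1 : cop 1 (1 ⊗ 1).
Proof. by move=> a b; rewrite tev_pure; apply: rmorphM. Qed.

End Coproduct.

Section TensorMap.
Variables (k : fieldType) (A B : algType k) (phi : {lrmorphism A -> B}).

Definition tmap (t : tens A A) : tens B B :=
  tens_sum (fun x y => phi x ⊗ phi y) t.

Fact tmap_bilinear :
  bilinear_for *:%R *:%R (fun x y => phi x ⊗ phi y : tens B B).
Proof.
by split=> [y|x] c u v; rewrite /applyr /= linearP;
  [apply: (tpure_bilinear _ _).1 | apply: (tpure_bilinear _ _).2].
Qed.

Fact tmap_linear : linear tmap.
Proof. exact/tens_sum_is_linear/tmap_bilinear. Qed.

HB.instance Definition _ :=
  GRing.isLinear.Build k (tens A A) (tens B B) _ tmap tmap_linear.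

Lemma tmap_pure x y : tmap (x ⊗ y) = phi x ⊗ phi y.
Proof. exact/tens_sum_pure/tmap_bilinear. Qed.

Lemma tmapM : {morph tmap : s t / s * t}.
Proof.
move=> s t; rewrite [LHS]tens_sum_mul; last exact: tmap_bilinear.
rewrite [RHS]big_distrlr; apply: eq_bigr => u _; apply: eq_bigr => v _ /=.
by rewrite !rmorphM tpureM.
Qed.

End TensorMap.

Lemma tens_lift (k : fieldType) (A B V : lmodType k) (f : A -> B -> V) :
  bilinear_for *:%R *:%R f ->
  exists L : {linear tens A B -> V}, forall t, L t = tens_sum f t.
Proof.
move=> fb; exists (HB.pack (tens_sum f)
  (GRing.isLinear.Build _ _ _ _ _ (tens_sum_is_linear fb)) : {linear _ -> _}).
by [].
Qed.

(** * Convolution inverses and the antipode axiom *)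

Section ConvolutionInverse.
Variables (k : fieldType) (K : hopfAlg k) (B : algType k).

Lemma mulr_bilinear (f g : {linear K -> B}) :
  bilinear_for *:%R *:%R (fun x y => f x * g y).
Proof.
by split=> [y|x] c u v; rewrite /applyr /= linearP ?mulrDl ?mulrDr;
  [rewrite -scalerAl | rewrite -scalerAr].
Qed.

(** The monoid argument [l = l (f r) = (l f) r = r], with coassociativity in the role of
    associativity. *)
Lemma convolution_inverse_unique (l f r : {linear K -> B}) :
  (forall a, tens_sum (fun x y => l x * f y) (comul a) = (counit a)%:A) ->
  (forall a, tens_sum (fun x y => f x * r y) (comul a) = (counit a)%:A) ->
  l =1 r.
Proof.
move=> lf fr a.
have [mu muE] := tens_lift (mulr_bilinear f r).
have mu_pure x y : mu (x ⊗ y) = f x * r y.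
  by rewrite muE; apply/tens_sum_pure/mulr_bilinear.
have lmu_bil : bilinear_for *:%R *:%R (fun x t => l x * mu t).
  by split=> [y|x] c u v; rewrite /applyr /= linearP ?mulrDl ?mulrDr;
    [rewrite -scalerAl | rewrite -scalerAr].
(* [nu] sends [x ⊗ (y ⊗ w)] to [l x * f y * r w]; on the two sides of coassociativity it gives [r a]
   and [l a]. *)
have [nu nuE] := tens_lift lmu_bil.
have nu_pure x t : nu (x ⊗ t) = l x * mu t by rewrite nuE; apply: tens_sum_pure.
have := congr1 nu (comulA a); rewrite !linear_tens_sum.
rewrite (eq_tens_sum (g := fun b c => counit b *: r c)); last first.
  move=> b c; rewrite -mulr_algl -lf linear_tens_sum [in RHS]/tens_sum mulr_suml.
  by apply: eq_bigr => u _; rewrite nu_pure mu_pure mulrA.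
rewrite [in RHS](eq_tens_sum (g := fun b c => counit c *: l b)); last first.
  by move=> b c; rewrite nu_pure muE fr mulr_algr.
rewrite -[l a]/(l _) -[in l a](counitr a) -[in r a](counitl a).
rewrite !linear_tens_sum => E; symmetry.
rewrite (eq_tens_sum (g := fun b c => counit b *: r c)); last first.
  by move=> b c; rewrite linearZ.
by rewrite E; apply: eq_tens_sum => b c; rewrite linearZ.
Qed.

End ConvolutionInverse.

Section DualPairing.
Variables (k : fieldType) (H K : hopfAlg k).
Variable p : {bilinear H -> K -> k | *%R & *%R}.

Fact pairing_functional_linear x : linear (fun a => p a x : k^o).
Proof. by move=> c a b; rewrite linearPl. Qed.

Definition pairing_functional x : dual H :=
  mkdual (HB.pack (fun a => p a x : k^o)
    (GRing.isLinear.Build _ _ _ _ _ (pairing_functional_linear x))).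

Fact pairing_functional_is_linear : linear pairing_functional.
Proof. by move=> c x y; apply: dualext => a; apply: (linearPr p a). Qed.

(* Both sides of the antipode axiom are convolution inverses of [p], seen as a
   map from [K] to the convolution algebra of [H]. *)
Lemma dual_pairing_antipode :
  (forall a x y, p a (x * y) = tens_sum (fun a1 a2 => p a1 x * p a2 y) (comul a)) ->
  (forall a b x, p (a * b) x = tens_sum (fun x1 x2 => p a x1 * p b x2) (comul x)) ->
  (forall a, p a 1 = counit a) -> (forall x, p 1 x = counit x) ->
  dual_pairing p.
Proof.
move=> pM pcM p1 pc1; split=> // a x.
pose F : {linear K -> dual H} := HB.pack pairing_functional
  (GRing.isLinear.Build _ _ _ _ _ pairing_functional_is_linear).
pose comp_antipode (f : dual H) : dual H := mkdual (dual_linear f \o antipode).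
have comp_linear : linear comp_antipode by move=> c f g; apply: dualext.
pose C : {linear dual H -> dual H} := HB.pack comp_antipode
  (GRing.isLinear.Build _ _ _ _ _ comp_linear).
have FE b y : F y b = p b y by [].
have CE f b : C f b = f (antipode b) by [].
have sumE (G : K -> K -> dual H) (t : tens K K) b :
  tens_sum G t b = tens_sum (fun y z => G y z b) t.
  exact: (linear_tens_sum (dual_eval b)).
(* The left inverse comes from the antipode of [H], the right inverse from that of [K]. *)
have := @convolution_inverse_unique k K (dual H) (C \o F) F (F \o antipode).
move=> /(_ _ _ x)/(congr1 (fun f : dual H => f a)); apply=> y.
  apply: dualext => b; rewrite sumE dualZE dual1E.
  transitivity (tens_sum (fun b1 b2 => p (antipode b1 * b2) y) (comul b)).
    rewrite [RHS](eq_tens_sum (g := fun b1 b2 =>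
      tens_sum (fun y1 y2 => p (antipode b1) y1 * p b2 y2) (comul y))) //.
    by rewrite /tens_sum [RHS]exchange_big; apply: eq_bigr.
  have := congr1 (p^~ y) (antipodel b); rewrite linearZl_LR pc1 mulrC => <-.
  by rewrite /tens_sum linear_sumlz.
apply: dualext => b; rewrite sumE dualZE dual1E.
transitivity (tens_sum (fun y1 y2 => p b (y1 * antipode y2)) (comul y)).
  by apply: eq_bigr => u _; rewrite pM.
have := congr1 (p b) (antipoder y); rewrite linearZr_LR p1 => <-.
by rewrite /tens_sum linear_sumr.
Qed.

End DualPairing.

(** * Translations of functionals *)

Section Translations.
Variables (k : fieldType) (H : hopfAlg k).
Implicit Types (a b c : H) (f g : dual H).

Fact ltrans_linear b f : linear (fun a => f (b * a)).
Proof. by move=> c x y; rewrite mulrDr -scalerAr linearP. Qed.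

Definition ltrans b f : dual H := mkdual (HB.pack (fun a => f (b * a))
  (GRing.isLinear.Build _ _ _ _ _ (ltrans_linear b f))).

Fact rtrans_linear b f : linear (fun a => f (a * b)).
Proof. by move=> c x y; rewrite mulrDl -scalerAl linearP. Qed.

Definition rtrans b f : dual H := mkdual (HB.pack (fun a => f (a * b))
  (GRing.isLinear.Build _ _ _ _ _ (rtrans_linear b f))).

Lemma ltransE b f a : ltrans b f a = f (b * a). Proof. by []. Qed.
Lemma rtransE b f a : rtrans b f a = f (a * b). Proof. by []. Qed.

Fact ltrans_linearr b : linear (ltrans b).
Proof. by move=> c f g; apply: dualext => a. Qed.
Fact rtrans_linearr b : linear (rtrans b).
Proof. by move=> c f g; apply: dualext => a. Qed.

HB.instance Definition _ b := GRing.isLinear.Build k (dual H) (dual H) _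
  (ltrans b) (ltrans_linearr b).
HB.instance Definition _ b := GRing.isLinear.Build k (dual H) (dual H) _
  (rtrans b) (rtrans_linearr b).

Lemma ltrans_linearl f : linear (ltrans^~ f).
Proof.
move=> c b b'; apply: dualext => a; rewrite dualDE dualZE !ltransE.
by rewrite mulrDl -scalerAl linearP.
Qed.

Lemma rtrans_linearl f : linear (rtrans^~ f).
Proof.
move=> c b b'; apply: dualext => a; rewrite dualDE dualZE !rtransE.
by rewrite mulrDr -scalerAr linearP.
Qed.

Lemma ltrans1 f : ltrans 1 f = f.
Proof. by apply: dualext => a; rewrite ltransE mul1r. Qed.
Lemma rtrans1 f : rtrans 1 f = f.
Proof. by apply: dualext => a; rewrite rtransE mulr1. Qed.

Lemma ltransM b c f : ltrans (b * c) f = ltrans c (ltrans b f).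
Proof. by apply: dualext => a; rewrite !ltransE mulrA. Qed.
Lemma rtransM b c f : rtrans (b * c) f = rtrans b (rtrans c f).
Proof. by apply: dualext => a; rewrite !rtransE mulrA. Qed.

Lemma lrtransC b c f : ltrans b (rtrans c f) = rtrans c (ltrans b f).
Proof. by apply: dualext => a; rewrite !(rtransE, ltransE) mulrA. Qed.

Definition ltrans2 f g (t : tens H H) : dual H :=
  tens_sum (fun b1 b2 => ltrans b1 f * ltrans b2 g) t.
Definition rtrans2 f g (t : tens H H) : dual H :=
  tens_sum (fun b1 b2 => rtrans b1 f * rtrans b2 g) t.

Fact ltrans2_bilinear f g :
  bilinear_for *:%R *:%R (fun b1 b2 => ltrans b1 f * ltrans b2 g).
Proof.
split=> [b2|b1] c x y; rewrite /applyr /= ltrans_linearl ?mulrDl ?mulrDr;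
  by [rewrite -scalerAl | rewrite -scalerAr].
Qed.

Fact rtrans2_bilinear f g :
  bilinear_for *:%R *:%R (fun b1 b2 => rtrans b1 f * rtrans b2 g).
Proof.
split=> [b2|b1] c x y; rewrite /applyr /= rtrans_linearl ?mulrDl ?mulrDr;
  by [rewrite -scalerAl | rewrite -scalerAr].
Qed.

HB.instance Definition _ f g := GRing.isLinear.Build k (tens H H) (dual H) _
  (ltrans2 f g) (tens_sum_is_linear (ltrans2_bilinear f g)).
HB.instance Definition _ f g := GRing.isLinear.Build k (tens H H) (dual H) _
  (rtrans2 f g) (tens_sum_is_linear (rtrans2_bilinear f g)).

Lemma ltrans2_pure f g b1 b2 :
  ltrans2 f g (b1 ⊗ b2) = ltrans b1 f * ltrans b2 g.
Proof. exact/tens_sum_pure/ltrans2_bilinear. Qed.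
Lemma rtrans2_pure f g b1 b2 :
  rtrans2 f g (b1 ⊗ b2) = rtrans b1 f * rtrans b2 g.
Proof. exact/tens_sum_pure/rtrans2_bilinear. Qed.

Lemma dual_sumE (A B : lmodType k) (F : A -> B -> dual H) (t : tens A B) a :
  tens_sum F t a = tens_sum (fun x y => F x y a) t.
Proof. exact: (linear_tens_sum (dual_eval a)). Qed.

(** Multiplicativity of the coproduct makes the dual a module algebra under translations: grouplike
    elements act multiplicatively, primitive ones as derivations, and [be] as a skew derivation. *)
Lemma ltrans_mul b f g : ltrans b (f * g) = ltrans2 f g (comul b).
Proof.
apply: dualext => a; rewrite ltransE dualME comulM dual_sumE.
by rewrite [LHS]tens_sum_mul //; apply: mul_bilinear.
Qed.

Lemma rtrans_mul b f g : rtrans b (f * g) = rtrans2 f g (comul b).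
Proof.
apply: dualext => a; rewrite rtransE dualME comulM dual_sumE.
rewrite [LHS]tens_sum_mul; last exact: mul_bilinear.
by rewrite [LHS]exchange_big.
Qed.

End Translations.

(** * Derivations along the counit *)

Section PrimitiveFunctional.
Variables (k : fieldType) (H : hopfAlg k).
Implicit Types (a b c : H) (f g : dual H).

Definition primitive_functional f := cop f (f ⊗ 1 + 1 ⊗ f).

Lemma primitive_functionalE f :
  primitive_functional f <->
  forall a b, f (a * b) = f a * counit b + counit a * f b.
Proof.
split=> fp a b; first by rewrite fp linearD /= !tev_pure.
by rewrite linearD /= !tev_pure fp.
Qed.

Lemma primitive_functional1 f : primitive_functional f -> f 1 = 0.
Proof.
move/primitive_functionalE/(_ 1 1); rewrite mulr1 rmorph1 mulr1 mul1r.
by move/eqP; rewrite -[X in X == _]addr0 (inj_eq (addrI _)) => /eqP.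
Qed.

Lemma primitive_functional_eq0 (I : Type) (g : I -> H) f :
  generates g -> primitive_functional f -> (forall i, f (g i) = 0) -> f = 0.
Proof.
move=> gen fp fg; apply: dualext; elim/(generates_ind gen) => //.
- exact: primitive_functional1.
- by move=> c a b fa fb; rewrite linearP /= fa fb scaler0 addr0.
- move/primitive_functionalE: fp => fp a b fa fb.
  by rewrite fp fa fb mul0r mulr0 addr0.
Qed.

End PrimitiveFunctional.

(** * The functionals X, Y and delta_n on U_CM *)

(** The counit law reads [counit a *: a = a], and the inverse cancels [a]. Since [is_UCM] prescribes
    only the coproduct, the counit has to be recovered in this way. *)
Lemma counit_grouplike (k : fieldType) (H : hopfAlg k) (a a' : H) :
  a * a' = 1 -> comul a = a ⊗ a -> counit a = 1.
Proof.
move=> aa' ca; have := counitl a; rewrite ca tens_sum_pure; last first.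
  by split=> [b|b] c x y; rewrite /applyr /=;
    [rewrite linearP /= scalerDl scalerA | rewrite scalerDr !scalerA mulrC].
move=> /(congr1 (fun b => b * a')); rewrite -scalerAl aa' => /(congr1 counit).
by rewrite linearZ /= rmorph1 => <-; rewrite [RHS]mulr1.
Qed.

Lemma comul_inverse (k : fieldType) (H : hopfAlg k) (a a' : H) :
  a * a' = 1 -> a' * a = 1 -> comul a = a ⊗ a -> comul a' = a' ⊗ a'.
Proof.
move=> aa' a'a ca.
have E : (a ⊗ a) * comul a' = 1 ⊗ 1 by rewrite -ca -comulM aa' comul1.
transitivity ((a' ⊗ a') * (a ⊗ a) * comul a').
  by rewrite tpureM a'a; exact/esym/mul1r.
by rewrite -mulrA E; exact: mulr1.
Qed.

(** * The counit of U_CM and a three-dimensional representation *)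

Section UCM.
Variables (k : fieldType) (U : hopfAlg k) (u : UCM_gen -> U).
Hypothesis UP : is_UCM u.

Local Notation al := (u UCM_alpha).
Local Notation al' := (u UCM_alphaV).
Local Notation be := (u UCM_beta).
Local Notation zz n := (u (UCM_z n)).

Lemma UCM_gen_u : generates u. Proof. by case: UP => -[]. Qed.

Lemma UCM_relP : UCM_rel u. Proof. by case: UP => -[]. Qed.

Lemma UCM_alphaKV : al * al' = 1. Proof. by case: UCM_relP => _ []. Qed.
Lemma UCM_alphaVK : al' * al = 1. Proof. by case: UCM_relP => _ []. Qed.

Lemma UCM_alphaC : al * be = be * al.
Proof. by case: UCM_relP => _ [_ _ /eqP]; rewrite subr_eq0 => /eqP. Qed.

Lemma UCM_alpha_z n : (2 <= n)%N -> al * zz n = zz n * al + n%:R *: (al * be ^+ n.-1).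
Proof.
case: UCM_relP => _ _ /(_ n) za _ /za /eqP.
rewrite /bracket subr_eq => /eqP ->.
by rewrite addrAC addNr add0r.
Qed.

Lemma UCM_beta_z n : (2 <= n)%N -> be * zz n = zz n * be + be ^+ n.
Proof.
case: UCM_relP => _ _ _ /(_ n) zb /zb /eqP.
by rewrite /bracket subr_eq => /eqP ->; rewrite addrAC addNr add0r.
Qed.

Lemma UCM_z0 : zz 0 = 0. Proof. by case: UCM_relP => -[]. Qed.
Lemma UCM_z1 : zz 1 = 0. Proof. by case: UCM_relP => -[]. Qed.

Lemma comul_alpha : comul al = al ⊗ al. Proof. by case: UP. Qed.
Lemma comul_beta : comul be = al ⊗ be + be ⊗ 1. Proof. by case: UP. Qed.
Lemma comul_z n : (2 <= n)%N -> comul (zz n) =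
  zz n ⊗ 1 + \sum_(2 <= j < n.+1)
    'C(n, j)%:R *: ((al ^+ j.-1 * be ^+ (n - j)) ⊗ zz j).
Proof. by case: UP => _ _ _; apply. Qed.
Lemma comul_alphaV : comul al' = al' ⊗ al'.
Proof. by apply: comul_inverse comul_alpha; [exact: UCM_alphaKV | exact: UCM_alphaVK]. Qed.

Lemma counit_alpha : counit al = 1.
Proof. exact: counit_grouplike UCM_alphaKV comul_alpha. Qed.

Lemma counit_alphaV : counit al' = 1.
Proof. by have := congr1 counit UCM_alphaKV; rewrite rmorphM /= counit_alpha mul1r rmorph1. Qed.

(** Having [counit ⊗ id] as a linear map turns an explicit coproduct into an equation for the
    counit. *)
Lemma counit_lift : exists L : {linear tens U U -> U},
  (forall a b, L (a ⊗ b) = counit a *: b) /\ (forall a, L (comul a) = a).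
Proof.
have bil : bilinear_for *:%R *:%R (fun a b : U => counit a *: b).
  by split=> [b|b] c x y; rewrite /applyr /=;
    [rewrite linearP /= scalerDl scalerA | rewrite scalerDr !scalerA mulrC].
have [L LE] := tens_lift bil; exists L; split=> [a b|a]; rewrite LE.
  exact: tens_sum_pure.
exact: counitl.
Qed.

Lemma counit_beta : counit be = 0.
Proof.
have [L [Lp Lc]] := counit_lift; have := Lc be.
rewrite comul_beta linearD !Lp counit_alpha scale1r => /eqP.
rewrite -[X in _ == X]addr0 (inj_eq (addrI _)) => /eqP /(congr1 counit).
by rewrite linearZ rmorph1 rmorph0 /= => <-; rewrite [RHS]mulr1.
Qed.

Lemma counit_alpha_beta i j : counit (al ^+ i * be ^+ j) = (j == 0%N)%:R.
Proof.
by rewrite rmorphM !rmorphXn /= counit_alpha counit_beta expr1n mul1r expr0n.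
Qed.

Lemma counit_z n : counit (zz n) = 0.
Proof.
case: n => [|[|n]]; rewrite ?UCM_z0 ?UCM_z1 ?rmorph0 //.
have [L [Lp Lc]] := counit_lift; have := Lc (zz n.+2).
(* The counit kills [be], so of the sum only [j = n] survives and gives back [z_n]; what remains is
   [counit z_n *: 1 = 0]. *)
rewrite comul_z // linearD linear_sum Lp big_nat_recr //= big_nat_cond big1.
  rewrite add0r linearZ /= Lp binn subnn counit_alpha_beta !scale1r => /eqP.
  rewrite -[X in _ == X]add0r (inj_eq (addIr _)) => /eqP /(congr1 counit).
  by rewrite linearZ rmorph1 rmorph0 /= => <-; rewrite [RHS]mulr1.
move=> j /andP[/andP[_ jn] _]; rewrite linearZ /= Lp counit_alpha_beta.
by rewrite subn_eq0 leqNgt jn scale0r scaler0.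
Qed.


Local Notation E i j := (delta_mx i j : 'M[k]_3).

(* [UCM_mx a] is the matrix of the values at [a] of [eps, Y, X; 0, eps, delta_1;
   0, 0, eps], i.e. the coproduct of [X] in HCM written as a representation. *)
Definition UCM_mx_gen (g : UCM_gen) : 'M[k]_3 :=
  match g with
  | UCM_z n => if n == 2 then 2%:R *: E 1 2 else 0
  | UCM_alpha => 1 + E 0 1
  | UCM_alphaV => 1 - E 0 1
  | UCM_beta => E 0 2
  end.

Lemma mul_delta (i j l m : 'I_3) : E i j * E l m = E i m *+ (j == l).
Proof. exact: mul_delta_mx_cond. Qed.

(** The matrix of [be] squares to zero and [z_n] vanishes for [n > 2], so the only relation on the
    [z_n] with content is [[z_2, al] = - 2 al be]. It comes from [E 0 1 * E 1 2 = E 0 2] while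
    [E 1 2 * E 0 1 = 0], which also fixes its sign. *)
Lemma UCM_mx_gen_rel : UCM_rel UCM_mx_gen.
Proof.
have bb n : (1 < n)%N -> E 0 2 ^+ n = 0.
  by case: n => [|[|n]] // _; rewrite !exprS mulrA mul_delta mul0r.
split.
- split=> // m n m2 n2 /=.
  have -> : ((m + n).-1 == 2) = false.
    by case: m n m2 n2 => [|[|m]] [|[|n]] // _ _; rewrite !addnS.
  rewrite scaler0 /bracket; case: (m == 2); case: (n == 2);
  by rewrite ?mul0r ?mulr0 ?subrr // -!scalerAl -!scalerAr mul_delta !scaler0 subrr.
- rewrite /bracket /=.
  split; rewrite ?(mulrDl, mulrDr, mul1r, mulr1, mulrN, mulNr, mul_delta) /=.
  + by rewrite mulr0n subr0 subrK.
  + by rewrite mulr0n subr0 addrK.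
  + by rewrite !mulr0n !addr0 subrr.
- move=> n n2 /=; rewrite /bracket; case: eqP => [->|nn2].
    rewrite expr1 mulrDl mulrDr mul1r mulr1 -scalerAl -scalerAr !mul_delta /=.
    rewrite mulr0n scaler0 addr0 mulrDl mul1r mul_delta /= mulr0n addr0.
    by rewrite opprD addrA subrr add0r.
  rewrite mul0r mulr0 subrr bb ?mulr0 ?scaler0 ?oppr0 //.
  by case: n n2 nn2 => [|[|[|n]]].
- move=> n n2 /=; rewrite /bracket; case: eqP => [->|nn2].
    rewrite -scalerAl -scalerAr !mul_delta /= bb //.
    by rewrite !scaler0 subrr oppr0.
  by rewrite mul0r mulr0 subrr bb // oppr0.
Qed.

Lemma UCM_mx_exists :
  exists r : {lrmorphism U -> 'M[k]_3}, forall i, r (u i) = UCM_mx_gen i.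
Proof. by case: UP => -[_ _ /(_ _ _ UCM_mx_gen_rel)]. Qed.

Definition UCM_mx := projT1 (cid UCM_mx_exists).

Lemma UCM_mxE i : UCM_mx (u i) = UCM_mx_gen i.
Proof. exact: (projT2 (cid UCM_mx_exists)). Qed.

Fact UCM_coef_linear i j : linear (fun a => UCM_mx a i j : k^o).
Proof. by move=> c a b; rewrite linearP !mxE. Qed.

Definition UCM_coef i j : dual U := mkdual (HB.pack (fun a => UCM_mx a i j : k^o)
  (GRing.isLinear.Build _ _ _ _ _ (UCM_coef_linear i j))).

Lemma UCM_coefE i j a : UCM_coef i j a = UCM_mx a i j. Proof. by []. Qed.

Lemma UCM_coefM i j a b :
  UCM_coef i j (a * b) = UCM_coef i 0 a * UCM_coef 0 j b +
    UCM_coef i 1 a * UCM_coef 1 j b + UCM_coef i 2 a * UCM_coef 2 j b.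
Proof.
rewrite !UCM_coefE rmorphM /= mxE !big_ord_recl big_ord0 addr0 addrA.
by congr (_ * _ + _ * _ + _ * _); congr (UCM_mx _ _ _); apply: val_inj.
Qed.

(** All entries are treated in one induction, since an entry of a product of matrices involves the
    other entries. *)
Lemma UCM_coef_low (i j : 'I_3) : (j <= i)%N -> UCM_coef i j = (i == j)%:R *: 1.
Proof.
move=> ij; apply: dualext => a; rewrite dualZE dual1E.
elim/(generates_ind UCM_gen_u): a i j ij.
- by move=> i j _; rewrite rmorph1 mulr1 UCM_coefE rmorph1 mxE.
- move=> c a b IHa IHb i j ij; rewrite UCM_coefE linearP !mxE -!UCM_coefE.
  by rewrite IHa // IHb // linearP mulrDr /= mulrCA.
- move=> a b IHa IHb i j ij; rewrite UCM_coefM rmorphM.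
  have [i0|i0] := eqVneq i 0.
    have j0 : j = 0 by apply: val_inj; move: ij; rewrite i0 leqn0 => /eqP.
    by rewrite i0 j0 (IHa 0 0) // (IHb 0 0) // (IHb 1 0) // (IHb 2 0) //=
      !mul1r !mul0r !mulr0 !addr0.
  have [i1|i1] := eqVneq i 1.
    have [j0|j0] := eqVneq j 0.
      by rewrite i1 j0 (IHa 1 0) // (IHa 1 1) // (IHb 1 0) // (IHb 2 0) //=
        !mul0r !mulr0 !addr0.
    have j1 : j = 1 by apply: val_inj; move: ij j0; rewrite i1; case: j => -[|[|[]]].
    by rewrite i1 j1 (IHa 1 0) // (IHa 1 1) // (IHb 1 1) // (IHb 2 1) //=
      !mul1r !mul0r !mulr0 add0r addr0.
  have i2 : i = 2 by apply: val_inj; move: i0 i1; case: i {ij} => -[|[|[]]].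
  rewrite i2 (IHa 2 0) // (IHa 2 1) // (IHa 2 2) // (IHb 2 j) //; last first.
    by case: j {ij} => -[|[|[]]].
  by rewrite /= !mul0r !add0r mul1r mulrCA.
- move=> g i j ij; rewrite UCM_coefE UCM_mxE.
  have Elow (l m : 'I_3) : (l < m)%N -> E l m i j = 0.
    move=> lm; rewrite mxE; case: (i =P l) => // il; case: (j =P m) => // jm.
    by move: lm; rewrite ltnNge -il -jm ij.
  case: g => [n|||] /=.
  + by case: eqP => _; rewrite counit_z mulr0 mxE ?Elow ?mulr0.
  + by rewrite counit_alpha mulr1 [LHS]mxE Elow // mxE addr0.
  + by rewrite counit_alphaV mulr1 [LHS]mxE [X in _ + X]mxE Elow // mxE subr0.
  + by rewrite counit_beta mulr0 Elow.
Qed.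

Lemma UCM_coef_diag i a : UCM_coef i i a = counit a.
Proof. by rewrite UCM_coef_low // eqxx scale1r. Qed.

Lemma UCM_coef_lt (i j : 'I_3) a : (j < i)%N -> UCM_coef i j a = 0.
Proof.
move=> ji; rewrite UCM_coef_low ?(ltnW ji) // dualZE (_ : i == j = false) ?mul0r //.
by apply/eqP => ij; rewrite ij ltnn in ji.
Qed.

End UCM.

(** * Values and brackets of X, Y and delta_1 *)

Section UCMDual.
Variables (k : fieldType) (U : hopfAlg k) (u : UCM_gen -> U).
Hypothesis UP : is_UCM u.

Local Notation al := (u UCM_alpha).
Local Notation al' := (u UCM_alphaV).
Local Notation be := (u UCM_beta).
Local Notation zz n := (u (UCM_z n)).

Definition dual_X := UCM_coef UP 0 2.
Definition dual_Y := UCM_coef UP 0 1.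
Definition dual_delta1 := UCM_coef UP 1 2.

Lemma dual_XM a b : dual_X (a * b) = dual_X a * counit b + counit a * dual_X b + dual_Y a * dual_delta1 b.
Proof. by rewrite [LHS]UCM_coefM !UCM_coef_diag [RHS]addrAC [in RHS]addrC addrA addrAC. Qed.

Lemma dual_YM a b : dual_Y (a * b) = dual_Y a * counit b + counit a * dual_Y b.
Proof.
rewrite [LHS]UCM_coefM !UCM_coef_diag (UCM_coef_lt UP (i := 2)) //.
by rewrite mulr0 addr0 addrC.
Qed.

Lemma dual_delta1M a b : dual_delta1 (a * b) = dual_delta1 a * counit b + counit a * dual_delta1 b.
Proof.
rewrite [LHS]UCM_coefM !UCM_coef_diag (UCM_coef_lt UP (i := 1)) //.
by rewrite mul0r add0r addrC.
Qed.

Lemma dual_X_cop : cop dual_X (dual_X ⊗ 1 + 1 ⊗ dual_X + dual_Y ⊗ dual_delta1).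
Proof. by move=> a b; rewrite dual_XM !linearD /= !tev_pure. Qed.

Lemma dual_Y_primitive : primitive_functional dual_Y.
Proof. by apply/primitive_functionalE => a b; apply: dual_YM. Qed.

Lemma dual_delta1_primitive : primitive_functional dual_delta1.
Proof. by apply/primitive_functionalE => a b; apply: dual_delta1M. Qed.

Ltac coef_gen := rewrite UCM_coefE UCM_mxE !mxE /= ?(mulr0, mulr1, addr0, subr0, add0r, sub0r).

Lemma dual_X_al : dual_X al = 0. Proof. by coef_gen. Qed.
Lemma dual_X_be : dual_X be = 1. Proof. by coef_gen. Qed.
Lemma dual_X_zz n : dual_X (zz n) = 0.
Proof. by rewrite UCM_coefE UCM_mxE /=; case: eqP; rewrite !mxE ?mulr0. Qed.
Lemma dual_Y_al : dual_Y al = 1. Proof. by coef_gen. Qed.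
Lemma dual_Y_be : dual_Y be = 0. Proof. by coef_gen. Qed.
Lemma dual_Y_zz n : dual_Y (zz n) = 0.
Proof. by rewrite UCM_coefE UCM_mxE /=; case: eqP; rewrite !mxE ?mulr0. Qed.
Lemma dual_delta1_al : dual_delta1 al = 0. Proof. by coef_gen. Qed.
Lemma dual_delta1_be : dual_delta1 be = 0. Proof. by coef_gen. Qed.
Lemma dual_delta1_zz n : dual_delta1 (zz n) = if n == 2 then 2%:R else 0.
Proof. by rewrite UCM_coefE UCM_mxE /=; case: eqP; rewrite !mxE ?mulr1. Qed.

Lemma dual_X_1 : dual_X 1 = 0. Proof. by rewrite UCM_coefE rmorph1 mxE. Qed.
Lemma dual_Y_1 : dual_Y 1 = 0. Proof. by rewrite UCM_coefE rmorph1 mxE. Qed.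

Lemma primitive_functional_alV f : primitive_functional f -> f al = 0 -> f al' = 0.
Proof.
move=> fp fa; have := primitive_functional1 fp; rewrite -(UCM_alphaKV UP).
move/primitive_functionalE: fp => ->.
by rewrite fa mul0r add0r (counit_alpha UP) mul1r.
Qed.

Lemma primitive_functional_UCM (f : dual U) :
  primitive_functional f -> f al = 0 -> f be = 0 ->
  (forall n, (2 <= n)%N -> f (zz n) = 0) -> f = 0.
Proof.
move=> fp fa fb fz; apply: (primitive_functional_eq0 (UCM_gen_u UP) fp).
case=> [[|[|n]]|||] //; rewrite ?(UCM_z0 UP) ?(UCM_z1 UP) ?linear0 ?fz //.
exact: primitive_functional_alV.
Qed.

Lemma rtrans_al_mul (f g : dual U) : rtrans al (f * g) = rtrans al f * rtrans al g.
Proof. by rewrite rtrans_mul (comul_alpha UP) rtrans2_pure. Qed.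

Lemma rtrans_be_mul (f g : dual U) :
  rtrans be (f * g) = rtrans al f * rtrans be g + rtrans be f * g.
Proof. by rewrite rtrans_mul (comul_beta UP) linearD /= !rtrans2_pure rtrans1. Qed.

Lemma ltrans_zz_mul n (f g : dual U) : (2 <= n)%N -> ltrans (zz n) (f * g) =
  ltrans (zz n) f * g + \sum_(2 <= j < n.+1)
    'C(n, j)%:R *: (ltrans (al ^+ j.-1 * be ^+ (n - j)) f * ltrans (zz j) g).
Proof.
move=> n2; rewrite ltrans_mul (comul_z UP) // linearD linear_sum /=.
rewrite ltrans2_pure ltrans1; congr (_ + _); apply: eq_bigr => j _.
by rewrite linearZ /= ltrans2_pure.
Qed.

Lemma dualM_al (f g : dual U) : (f * g) al = f al * g al.
Proof. by rewrite dualME (comul_alpha UP) tev_pure. Qed.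

Lemma dualM_be (f g : dual U) : (f * g) be = f al * g be + f be * g 1.
Proof. by rewrite dualME (comul_beta UP) linearD /= !tev_pure. Qed.

Lemma dualM_zz n (f g : dual U) : (2 <= n)%N -> (f * g) (zz n) =
  f (zz n) * g 1 + \sum_(2 <= j < n.+1)
    'C(n, j)%:R * (f (al ^+ j.-1 * be ^+ (n - j)) * g (zz j)).
Proof.
move=> n2; rewrite dualME (comul_z UP) // linearD linear_sum /= tev_pure.
by congr (_ + _); apply: eq_bigr => j _; rewrite linearZ /= tev_pure.
Qed.

Lemma dual_Y_mul_be a j : dual_Y (a * be ^+ j.+1) = 0.
Proof.
by rewrite exprSr mulrA dual_YM (counit_beta UP) dual_Y_be !mulr0 addr0.
Qed.

Lemma dual_X_mul_be a : dual_X (a * be) = counit a.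
Proof. by rewrite dual_XM (counit_beta UP) dual_X_be dual_delta1_be !mulr0 mulr1 add0r addr0. Qed.

Lemma dual_X_expal i : dual_X (al ^+ i) = 0.
Proof.
elim: i => [|i IHi]; first by rewrite expr0 dual_X_1.
rewrite exprSr dual_XM IHi dual_X_al dual_delta1_al.
by rewrite !mulr0 mul0r !addr0.
Qed.

Lemma dual_X_al_be i j : dual_X (al ^+ i * be ^+ j) = (j == 1%N)%:R.
Proof.
case: j => [|j]; first by rewrite expr0 mulr1 dual_X_expal.
by rewrite exprSr mulrA dual_X_mul_be (counit_alpha_beta UP) eqSS.
Qed.

End UCMDual.

Arguments dual_X : simpl never.
Arguments dual_Y : simpl never.
Arguments dual_delta1 : simpl never.

Lemma primitive_functional_bracket (k : fieldType) (H : hopfAlg k) (f g : dual H) :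
  primitive_functional f -> primitive_functional g ->
  primitive_functional ⁅f, g⁆.
Proof.
move=> fp gp; apply/primitive_functionalE => a b.
rewrite (cop_bracket fp gp) !dualDE !dualNE.
rewrite !(mulrDl, mulrDr, tpureM, mul1r, mulr1).
rewrite !(linearD, linearN) /= !tev_pure /= /dual_eval ?dual1E.
ring.
Qed.

Lemma primitive_functionalB (k : fieldType) (H : hopfAlg k) (f g : dual H) :
  primitive_functional f -> primitive_functional g ->
  primitive_functional (f - g).
Proof.
move=> /primitive_functionalE fp /primitive_functionalE gp.
by apply/primitive_functionalE => a b; rewrite !dualDE !dualNE fp gp; ring.
Qed.

Section UCMDual.
Variables (k : fieldType) (U : hopfAlg k) (u : UCM_gen -> U).
Hypothesis UP : is_UCM u.

Local Notation al := (u UCM_alpha).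
Local Notation al' := (u UCM_alphaV).
Local Notation be := (u UCM_beta).
Local Notation zz n := (u (UCM_z n)).
Local Notation dual_X := (dual_X UP).
Local Notation dual_Y := (dual_Y UP).
Local Notation dual_delta1 := (dual_delta1 UP).

Lemma bracket_dual_Y_delta1 : ⁅dual_Y, dual_delta1⁆ = dual_delta1.
Proof.
apply/eqP; rewrite -subr_eq0; apply/eqP; apply: (primitive_functional_UCM UP).
- apply/primitive_functionalB/dual_delta1_primitive/primitive_functional_bracket.
    exact: dual_Y_primitive.
  exact: dual_delta1_primitive.
- by rewrite !dualDE !dualNE !(dualM_al UP) dual_delta1_al; ring.
- by rewrite !dualDE !dualNE !(dualM_be UP) dual_delta1_be dual_delta1_al dual_Y_be; ring.
- move=> n n2; rewrite !dualDE !dualNE !(dualM_zz UP) //.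
  rewrite dual_Y_zz dual_delta1_zz dual_Y_1 [X in _ - (_ + X) - _]big1 => [|j _]; last first.
    by rewrite dual_Y_zz !mulr0.
  (* Among the [z_j], [dual_delta1] sees only [z_2], and then [dual_Y] kills [al * be ^+ (n - 2)]
     unless [n = 2]. *)
  rewrite big_ltn //= big_add1 /= big_nat_cond big1 => [|j /andP[/andP[j2 jn] _]].
    move: n2; rewrite leq_eqVlt => /predU1P[<-|n2].
      rewrite subnn expr0 mulr1 expr1 dual_Y_al dual_delta1_zz eqxx binn; ring.
    by rewrite (gtn_eqF n2) -(subnSK n2) dual_Y_mul_be; ring.
  by rewrite dual_delta1_zz; case: j j2 jn => [|[|j]] // _ _; rewrite !mulr0.
Qed.

(** [dual_X] is not a derivation along the counit, but the defects of the two sides agree, being [Y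
    ⊗ [Y, delta_1]] and [Y ⊗ delta_1]. The difference is therefore such a derivation and can be
    tested on generators. *)
Lemma bracket_dual_Y_X : ⁅dual_Y, dual_X⁆ = dual_X.
Proof.
apply/eqP; rewrite -subr_eq0; apply/eqP; apply: (primitive_functional_UCM UP).
- apply/primitive_functionalE => a b.
  have fYf1 c : (dual_Y * dual_delta1) c = dual_delta1 c + (dual_delta1 * dual_Y) c.
    have := congr1 (fun f : dual U => f c) bracket_dual_Y_delta1.
    by rewrite dualDE dualNE => <-; ring.
  rewrite dualDE dualNE dual_XM (cop_bracket (dual_Y_primitive UP) (dual_X_cop UP)).
  rewrite !dualDE !dualNE !(mulrDl, mulrDr, tpureM, mul1r, mulr1).
  rewrite !(linearD, linearN) /= !tev_pure /= /dual_eval ?dual1E fYf1.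
  ring.
- by rewrite !dualDE !dualNE !(dualM_al UP) dual_X_al; ring.
- by rewrite !dualDE !dualNE !(dualM_be UP) dual_X_be dual_X_al dual_Y_be dual_Y_al dual_X_1 dual_Y_1; ring.
- move=> n n2; rewrite !dualDE !dualNE !(dualM_zz UP) //.
  rewrite dual_Y_zz dual_X_zz !big1 => [|j _|j _]; first by ring.
    by rewrite dual_Y_zz !mulr0.
  by rewrite dual_X_zz !mulr0.
Qed.

End UCMDual.

(** * Functionals invariant under k[B_+] or under U(d_0) *)

Section UCMInvariant.
Variables (k : fieldType) (U : hopfAlg k) (u : UCM_gen -> U).
Hypothesis UP : is_UCM u.

Local Notation al := (u UCM_alpha).
Local Notation al' := (u UCM_alphaV).
Local Notation be := (u UCM_beta).
Local Notation zz n := (u (UCM_z n)).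
Local Notation dual_X := (dual_X UP).
Local Notation dual_Y := (dual_Y UP).
Local Notation dual_delta1 := (dual_delta1 UP).
Implicit Types f g : dual U.

(* The functionals on the quotient of [UCM] by the left ideal generated by the
   augmentation ideal of [k[B_+]], which is isomorphic to [U(d_0)]. *)
Definition kBp_invariant f := rtrans al f = f /\ rtrans be f = 0.

Lemma kBp_invariant_alV f : kBp_invariant f -> rtrans al' f = f.
Proof. by case=> fa _; rewrite -{1}fa -rtransM (UCM_alphaVK UP) rtrans1. Qed.

Lemma kBp_invariantL c f g :
  kBp_invariant f -> kBp_invariant g -> kBp_invariant (c *: f + g).
Proof.
by case=> fa fb [ga gb]; split; rewrite linearP /= ?fa ?fb ?ga ?gb // scaler0 addr0.
Qed.

Lemma kBp_invariant0 : kBp_invariant 0.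
Proof. by split; rewrite linear0. Qed.

Lemma kBp_invariant1 : kBp_invariant 1.
Proof.
split; apply: dualext => a; rewrite rtransE !dual1E rmorphM /=.
  by rewrite (counit_alpha UP) mulr1.
by rewrite (counit_beta UP) mulr0.
Qed.

Lemma kBp_invariantM f g :
  kBp_invariant f -> kBp_invariant g -> kBp_invariant (f * g).
Proof.
case=> fa fb [ga gb]; split; first by rewrite (rtrans_al_mul UP) fa ga.
by rewrite (rtrans_be_mul UP) fb gb mulr0 mul0r addr0.
Qed.

Lemma kBp_invariant_ltrans b f : kBp_invariant f -> kBp_invariant (ltrans b f).
Proof. by case=> fa fb; split; rewrite -lrtransC ?fa ?fb ?linear0. Qed.

Lemma kBp_invariant_dual_delta1 : kBp_invariant dual_delta1.
Proof.
split; apply: dualext => a; rewrite rtransE dual_delta1M.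
  by rewrite dual_delta1_al (counit_alpha UP) mulr0 mulr1 addr0.
by rewrite dual_delta1_be (counit_beta UP) !mulr0 addr0.
Qed.

Lemma rtrans_al_dual_X : rtrans al dual_X = dual_X.
Proof.
apply: dualext => a; rewrite rtransE dual_XM.
by rewrite dual_X_al dual_delta1_al (counit_alpha UP) !mulr0 mulr1 !addr0.
Qed.

Lemma rtrans_be_dual_X : rtrans be dual_X = 1.
Proof. by apply: dualext => a; rewrite rtransE dual_X_mul_be. Qed.

(** Right translation by [be] is a skew derivation that kills [f] and sends [dual_X] to 1, so the
    two terms of the bracket contribute [f - f]. *)
Lemma kBp_invariant_bracket_dual_X f : kBp_invariant f -> kBp_invariant ⁅dual_X, f⁆.
Proof.
case=> fa fb; split; rewrite /bracket linearB /= ?(rtrans_al_mul UP).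
  by rewrite rtrans_al_dual_X fa.
rewrite !(rtrans_be_mul UP) rtrans_al_dual_X rtrans_be_dual_X fa fb.
by rewrite mulr0 mul0r mul1r mulr1 add0r addr0 subrr.
Qed.

(** Moving [al] or [be] to the right past [z_n] creates only terms containing a positive power of
    [be]. So the left ideal generated by the augmentation ideal of [k[B_+]] is two-sided, and right
    invariance implies left invariance. The induction quantifies over [f] because left translates of
    [f] appear. *)
Lemma kBp_invariant_left a f : kBp_invariant f -> f (al * a) = f a /\ f (be * a) = 0.
Proof.
have al'be : be * al' = al' * be.
  by rewrite -[LHS]mul1r -(UCM_alphaVK UP) -mulrA [al * _]mulrA (UCM_alphaC UP) -!mulrA
    (UCM_alphaKV UP) mulr1.
elim/(generates_ind_mul (UCM_gen_u UP)): a f => [|c a b IHa IHb|g a IH] f fP.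
- by case: fP => [fa fb]; rewrite !mulr1 -[in RHS]fa -[f be]/(f be)
    -[f be]mulr1; split; [rewrite rtransE mul1r | rewrite mulr1 -[be]mul1r -rtransE fb].
- have [fa fb] := IHa f fP; have [ga gb] := IHb f fP.
  rewrite !mulrDr -!scalerAr !linearP /= fa ga fb gb.
  by rewrite scaler0 addr0.
have IHl b : f (b * (al * a)) = f (b * a).
  by have [] := IH _ (kBp_invariant_ltrans b fP).
have IHr b : f (b * (be * a)) = 0.
  by have [] := IH _ (kBp_invariant_ltrans b fP).
have IHrn b n : f (b * be ^+ n.+1 * a) = 0.
  by rewrite exprSr mulrA -mulrA IHr.
case: g => [[|[|n]]|||].
- by rewrite (UCM_z0 UP) mul0r !mulr0 linear0.
- by rewrite (UCM_z1 UP) mul0r !mulr0 linear0.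
- have := IHrn 1 n.+1; rewrite mul1r !mulrA (UCM_alpha_z UP) // (UCM_beta_z UP) // !mulrDl.
  move: (be ^+ n.+2) => w fw; rewrite !linearD /= fw.
  by rewrite -scalerAl linearZ /= IHrn -!mulrA IHl IHr scaler0 !addr0.
- by rewrite IHl mulrA -(UCM_alphaC UP) -mulrA IHr.
- split; first by rewrite mulrA (UCM_alphaKV UP) mul1r -IHl mulrA (UCM_alphaVK UP) mul1r.
  by rewrite mulrA al'be -mulrA IHr.
- by rewrite mulrA (UCM_alphaC UP) -mulrA IHl IHr.
Qed.

Lemma ltrans_al_invariant f : kBp_invariant f -> ltrans al f = f.
Proof. by move=> fP; apply: dualext => a; have [] := kBp_invariant_left a fP. Qed.

Lemma ltrans_be_invariant f : kBp_invariant f -> ltrans be f = 0.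
Proof. by move=> fP; apply: dualext => a; have [] := kBp_invariant_left a fP. Qed.

Lemma ltrans_xi_invariant i j f : kBp_invariant f ->
  ltrans (al ^+ i * be ^+ j) f = (j == 0)%:R *: f.
Proof.
move=> fP; rewrite ltransM.
have -> : ltrans (al ^+ i) f = f.
  by elim: i => [|i IH]; rewrite ?ltrans1 // exprS ltransM ltrans_al_invariant.
case: j => [|j]; first by rewrite ltrans1 scale1r.
by rewrite exprS ltransM ltrans_be_invariant // linear0 scale0r.
Qed.

(** Translation by [al ^+ j.-1 * be ^+ (n - j)] fixes [f] for [j = n] and kills it otherwise. Only
    [f] is invariant here: the factorization of the pairing takes for [g] an element from the
    [U(b_+)] side. *)
Lemma ltrans_zz_invariant n f g : (2 <= n)%N -> kBp_invariant f ->
  ltrans (zz n) (f * g) = ltrans (zz n) f * g + f * ltrans (zz n) g.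
Proof.
move=> n2 fP; rewrite (ltrans_zz_mul UP) //; congr (_ + _).
rewrite big_nat_recr //= big_nat_cond big1 => [|j /andP[/andP[_ jn] _]].
  by rewrite add0r binn subnn ltrans_xi_invariant // !scale1r.
by rewrite ltrans_xi_invariant // subn_eq0 leqNgt jn scale0r mul0r scaler0.
Qed.

(* On the invariant functionals, [z_n] acts like a primitive element, as in the
   cocommutative Hopf algebra [U(d_0)]. *)
Lemma kBp_invariant_commute f g :
  kBp_invariant f -> kBp_invariant g -> f * g = g * f.
Proof.
move=> fP gP; apply: dualext => a.
elim/(generates_ind_mul (UCM_gen_u UP)): a f g fP gP
    => [|c a b IHa IHb|i a IH] f g fP gP.
- by rewrite !dualME comul1 !tev_pure mulrC.
- by rewrite !linearP /= IHa // IHb.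
have fgP := kBp_invariantM fP gP; have gfP := kBp_invariantM gP fP.
rewrite -!ltransE; case: i => [[|[|n]]|||].
- by rewrite !ltransE (UCM_z0 UP) mul0r !linear0.
- by rewrite !ltransE (UCM_z1 UP) mul0r !linear0.
- rewrite !ltrans_zz_invariant // !dualDE addrC.
  by rewrite IH ?[(ltrans _ _ * _) _]IH //; apply: kBp_invariant_ltrans.
- by rewrite !ltrans_al_invariant // IH.
- rewrite -(ltrans_al_invariant fgP) -(ltrans_al_invariant gfP) -!ltransM (UCM_alphaKV UP).
  by rewrite !ltrans1 IH.
- by rewrite !ltrans_be_invariant.
Qed.

(* The functionals on [UCM] which vanish on the right ideal generated by the
   augmentation ideal of [U(d_0)]. *)
Definition d0_invariant f := forall n, (2 <= n)%N -> ltrans (zz n) f = 0.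

Lemma d0_invariantL c f g :
  d0_invariant f -> d0_invariant g -> d0_invariant (c *: f + g).
Proof. by move=> fP gP n n2; rewrite linearP /= fP // gP // scaler0 addr0. Qed.

Lemma d0_invariant1 : d0_invariant 1.
Proof.
by move=> n n2; apply: dualext => a; rewrite ltransE dual1E rmorphM /= (counit_z UP) mul0r.
Qed.

Lemma d0_invariantM f g : d0_invariant f -> d0_invariant g -> d0_invariant (f * g).
Proof.
move=> fP gP n n2; rewrite (ltrans_zz_mul UP) // fP // mul0r add0r.
rewrite big_nat_cond big1 // => j /andP[/andP[j2 _] _].
by rewrite gP // mulr0 scaler0.
Qed.

Lemma d0_invariant_dual_X : d0_invariant dual_X.
Proof.
move=> n n2; apply: dualext => a; rewrite ltransE dual_XM.
by rewrite dual_X_zz dual_Y_zz (counit_z UP) !mul0r !addr0.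
Qed.

Lemma d0_invariant_dual_Y : d0_invariant dual_Y.
Proof.
move=> n n2; apply: dualext => a; rewrite ltransE dual_YM.
by rewrite dual_Y_zz (counit_z UP) !mul0r !addr0.
Qed.

Fixpoint dual_delta_succ n : dual U :=
  if n is m.+1 then ⁅dual_X, dual_delta_succ m⁆ else dual_delta1.

Definition dual_delta n := if n is m.+1 then dual_delta_succ m else 0.

Lemma dual_delta_invariant n : kBp_invariant (dual_delta n).
Proof.
case: n => [|n]; first exact: kBp_invariant0.
elim: n => [|n IHn]; first exact: kBp_invariant_dual_delta1.
exact: kBp_invariant_bracket_dual_X.
Qed.

Definition HCM_fun (g : HCM_gen) : dual U :=
  match g with HCM_X => dual_X | HCM_Y => dual_Y | HCM_delta n => dual_delta n end.

Lemma HCM_fun_rel : HCM_rel HCM_fun.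
Proof.
split=> //=.
- exact: bracket_dual_Y_X.
- by case.
- case=> // n _; elim: n => [|n /= IHn]; first by rewrite scale1r; apply: bracket_dual_Y_delta1.
  (* By the Jacobi identity [ad Y] acts on [[X, delta_n]] by the sum of the weights of [X] and
     [delta_n], that is [1 + n]. *)
  have jac (x y z : dual U) : ⁅x, ⁅y, z⁆⁆ = ⁅⁅x, y⁆, z⁆ + ⁅y, ⁅x, z⁆⁆.
    rewrite /bracket !(mulrBl, mulrBr) !mulrA !opprB !addrA.
    set a := x * y * z; set b := x * z * y; set c := y * z * x; set d := z * y * x.
    set e := y * x * z; set f := z * x * y.
    rewrite [in RHS](ACl (1 * 8 * 3 * 6 * (7 * 4) * (2 * 5))) /=.
    by rewrite addNr subrr !addr0.
  have bracketZ c (x y : dual U) : ⁅x, c *: y⁆ = c *: ⁅x, y⁆.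
    by rewrite /bracket -scalerAl -scalerAr -scalerBr.
  by rewrite jac bracket_dual_Y_X IHn bracketZ -[X in X + _]scale1r -scalerDl nat1r.
- move=> m n _ _; apply/eqP; rewrite subr_eq0; apply/eqP.
  by apply: kBp_invariant_commute; apply: dual_delta_invariant.
Qed.

End UCMInvariant.

(** * The pairings *)

Section MorphismPairing.
Variables (k : fieldType) (H K : hopfAlg k) (F : {lrmorphism K -> dual H}).

Fact morphism_pairing_bilinear :
  bilinear_for *%R *%R (fun (a : H) (x : K) => F x a : k).
Proof. by split=> [x|a] c y z; rewrite /applyr /= linearP. Qed.

Definition morphism_pairing : {bilinear H -> K -> k | *%R & *%R} :=
  HB.pack (fun (a : H) (x : K) => F x a : k)
    (bilinear_isBilinear.Build k H K k _ _ _ morphism_pairing_bilinear).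

Lemma morphism_pairingE a x : morphism_pairing a x = F x a. Proof. by []. Qed.

Lemma cop_tmapE x : cop (F x) (tmap F (comul x)) <->
  forall a b, F x (a * b) = tens_sum (fun y z => F y a * F z b : k^o) (comul x).
Proof.
suff tmapE a b : tev (dual_eval a) (dual_eval b) (tmap F (comul x)) =
    tens_sum (fun y z => F y a * F z b : k^o) (comul x).
  by split=> Fx a b; have := Fx a b; rewrite tmapE.
by rewrite linear_tens_sum; apply: eq_tens_sum => y z; apply: tev_pure.
Qed.

Lemma cop_tmap_generates (I : Type) (g : I -> K) : generates g ->
  (forall i, cop (F (g i)) (tmap F (comul (g i)))) ->
  forall x, cop (F x) (tmap F (comul x)).
Proof.
move=> gen Fg; apply: (generates_ind gen) Fg => [|c x y|x y].
- by rewrite comul1 tmap_pure rmorph1; apply: cop1.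
- by rewrite !linearP; apply: copL.
- by rewrite rmorphM comulM tmapM; apply: copM.
Qed.

Lemma morphism_dual_pairing :
  (forall x, cop (F x) (tmap F (comul x))) -> (forall x, F x 1 = counit x) ->
  dual_pairing morphism_pairing.
Proof.
move=> Fcop F1; apply: dual_pairing_antipode => [a x y|a b x|a|x].
- by rewrite morphism_pairingE rmorphM.
- by rewrite morphism_pairingE; have /cop_tmapE := Fcop x; apply.
- by rewrite morphism_pairingE rmorph1.
- exact: F1.
Qed.

End MorphismPairing.

Arguments morphism_pairing : simpl never.

Section Pullback.
Variables (k : fieldType) (A U : hopfAlg k) (m : {lrmorphism A -> U}).

Definition pullback (f : dual U) : dual A := mkdual (dual_linear f \o m).

Lemma pullbackE f a : pullback f a = f (m a). Proof. by []. Qed.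

Fact pullback_linear : linear pullback.
Proof. by move=> c f g; apply: dualext. Qed.

HB.instance Definition _ :=
  GRing.isLinear.Build k (dual U) (dual A) _ pullback pullback_linear.

Lemma ltrans_pullback a f : ltrans a (pullback f) = pullback (ltrans (m a) f).
Proof. by apply: dualext => b; rewrite !(ltransE, pullbackE) rmorphM. Qed.

Lemma comul_generates (I : Type) (g : I -> A) : generates g ->
  (forall i, comul (m (g i)) = tmap m (comul (g i))) ->
  forall a, comul (m a) = tmap m (comul a).
Proof.
move=> gen mg; apply: (generates_ind gen) mg => [|c x y|x y].
- by rewrite rmorph1 !comul1 tmap_pure rmorph1.
- by move=> mx my; rewrite !linearP /= mx my.
- by move=> mx my; rewrite rmorphM !comulM tmapM mx my.
Qed.

Lemma pullbackM (f g : dual U) : (forall a, comul (m a) = tmap m (comul a)) ->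
  pullback (f * g) = pullback f * pullback g.
Proof.
move=> mcomul; apply: dualext => a; rewrite pullbackE !dualME mcomul.
by rewrite linear_tens_sum; apply: eq_tens_sum => x y; apply: tev_pure.
Qed.

End Pullback.

(** * The pairing of U_CM with H_CM *)

Section Phi.
Variables (k : fieldType) (U : hopfAlg k) (u : UCM_gen -> U).
Hypothesis UP : is_UCM u.
Variables (H : hopfAlg k) (h : HCM_gen -> H).
Hypothesis HP : is_HCM h.

Lemma HCM_gen_h : generates h. Proof. by case: HP => -[]. Qed.
Lemma HCM_relP : HCM_rel h. Proof. by case: HP => -[]. Qed.

Lemma HCM_morphism_exists :
  exists r : {lrmorphism H -> dual U}, forall i, r (h i) = HCM_fun UP i.
Proof. by case: HP => -[_ _ /(_ _ _ (HCM_fun_rel UP))]. Qed.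

Definition HCM_morphism := projT1 (cid HCM_morphism_exists).

Lemma HCM_morphismE i : HCM_morphism (h i) = HCM_fun UP i.
Proof. exact: (projT2 (cid HCM_morphism_exists)). Qed.

Lemma HCM_delta_rec n : h (HCM_delta n.+2) = ⁅h HCM_X, h (HCM_delta n.+1)⁆.
Proof. by case: HCM_relP => _ _ ->. Qed.

(** The coproduct of [delta_n] is given only inductively. Both sides respect products, so the case
    of [delta_{n+2} = [X, delta_{n+1}]] follows from those of [X] and [delta_{n+1}]. *)
Lemma HCM_morphism_cop x : cop (HCM_morphism x) (tmap HCM_morphism (comul x)).
Proof.
move: x; apply: cop_tmap_generates HCM_gen_h _ => i.
case: HP => _ [cX cY cd1] _ _.
have copX : cop (HCM_morphism (h HCM_X)) (tmap HCM_morphism (comul (h HCM_X))).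
  rewrite cX !linearD /= !tmap_pure rmorph1 !HCM_morphismE; exact: dual_X_cop.
case: i => [//||n].
  rewrite cY !linearD /= !tmap_pure rmorph1 !HCM_morphismE; exact: dual_Y_primitive.
case: n => [|n].
  by have [-> _ _ _ _] := HCM_relP; rewrite !linear0 => a b; rewrite linear0.
elim: n => [|n IHn].
  rewrite cd1 !linearD /= !tmap_pure rmorph1 !HCM_morphismE; exact: dual_delta1_primitive.
rewrite HCM_delta_rec /bracket !linearB /= !comulM !tmapM !rmorphM.
exact: cop_bracket.
Qed.

Lemma HCM_morphism1 x : HCM_morphism x 1 = counit x.
Proof.
have M1 (f g : dual U) : (f * g) 1 = f 1 * g 1.
  by rewrite dualME comul1 tev_pure.
elim/(generates_ind HCM_gen_h): x => [|c x y hx hy|x y hx hy|i].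
- by rewrite !rmorph1 dual1E rmorph1.
- by rewrite !linearP /= -hx -hy.
- by rewrite !rmorphM /= M1 hx hy.
case: HP => _ _ [eX eY ed] _; rewrite HCM_morphismE.
case: i => [||[|n]] /=; rewrite ?eX ?eY ?ed.
- exact: dual_X_1.
- exact: dual_Y_1.
- by [].
case: n => [|n /=]; first exact/primitive_functional1/dual_delta1_primitive.
(* Evaluation at 1 is a character of the convolution algebra, so it kills brackets. *)
by rewrite dualDE dualNE !M1 mulrC subrr.
Qed.

Definition HCM_pairing := morphism_pairing HCM_morphism.

Lemma HCM_dual_pairing : dual_pairing HCM_pairing.
Proof. exact: morphism_dual_pairing HCM_morphism_cop HCM_morphism1. Qed.

End Phi.

Arguments HCM_pairing : simpl never.

Lemma counit_primitive (k : fieldType) (A : hopfAlg k) (a : A) :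
  primitive a -> counit a = 0.
Proof.
move=> ap; have [L [Lp Lc]] := counit_lift A; have := Lc a.
rewrite ap linearD /= !Lp rmorph1 scale1r => /eqP.
rewrite -[X in _ == X]add0r (inj_eq (addIr _)) => /eqP /(congr1 counit).
by rewrite linearZ rmorph1 rmorph0 /= => <-; rewrite [RHS]mulr1.
Qed.

Lemma ltrans_primitive_mul (k : fieldType) (A : hopfAlg k) (a : A) (f g : dual A) :
  primitive a -> ltrans a (f * g) = ltrans a f * g + f * ltrans a g.
Proof.
by move=> ap; rewrite ltrans_mul ap linearD /= !ltrans2_pure !ltrans1.
Qed.

Lemma tens_sum_tens_sum (k : fieldType) (A B A' B' V : lmodType k)
    (f : A' -> B' -> V) (g : A -> B -> tens A' B') (x : tens A B) :
  bilinear_for *:%R *:%R f ->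
  tens_sum f (tens_sum g x) = tens_sum (fun a b => tens_sum f (g a b)) x.
Proof.
by move=> /tens_lift[L LE]; rewrite -LE linear_tens_sum; apply: eq_tens_sum => a b.
Qed.

(** * The pairing of U(d_0) with k[D_0] *)

Section D0Pairing.
Variables (k : fieldType) (U : hopfAlg k) (u : UCM_gen -> U).
Hypothesis UP : is_UCM u.
Variables (H : hopfAlg k) (h : HCM_gen -> H).
Hypothesis HP : is_HCM h.
Variables (V : hopfAlg k) (z : nat -> V).
Hypothesis VP : is_Ud0 z.
Variables (D : hopfAlg k) (d : nat -> D) (i : {lrmorphism D -> H}).
Hypothesis DP : is_kD0 h d i.

Local Notation phi := (HCM_morphism UP HP).
Local Notation zz n := (u (UCM_z n)).

Lemma Ud0_gen_z : generates z. Proof. by case: VP => -[]. Qed.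

Lemma Ud0_z_small n : (n < 2)%N -> z n = 0.
Proof. by case: VP => -[[z0 z1 _] _ _] _; case: n => [|[]]. Qed.

Lemma kD0_gen_d : generates d. Proof. by case: DP. Qed.

Lemma kD0_d n : i (d n) = h (HCM_delta n). Proof. by case: DP. Qed.

Lemma UCM_Ud0_rel : Ud0_rel (fun n => zz n).
Proof. by case: (UCM_relP UP). Qed.

Lemma Ud0_morphism_exists : exists r : {lrmorphism V -> U}, forall n, r (z n) = zz n.
Proof. by case: VP => -[_ _ /(_ _ _ UCM_Ud0_rel)]. Qed.

Definition Ud0_morphism := projT1 (cid Ud0_morphism_exists).
Local Notation kap := Ud0_morphism.

Lemma Ud0_morphismE n : kap (z n) = zz n.
Proof. exact: (projT2 (cid Ud0_morphism_exists)). Qed.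

Lemma kD0_invariant t : kBp_invariant u (phi (i t)).
Proof.
elim/(generates_ind kD0_gen_d): t => [|c s t sP tP|s t sP tP|n].
- by rewrite !rmorph1; apply: kBp_invariant1.
- by rewrite !linearP; apply: kBp_invariantL.
- by rewrite !rmorphM; apply: kBp_invariantM.
- by rewrite kD0_d HCM_morphismE; apply: dual_delta_invariant.
Qed.

(* [kap] is not a coalgebra morphism, but it is one modulo the left ideal which
   the invariant functionals annihilate. *)
Lemma pullback_invariantM f g : kBp_invariant u f -> kBp_invariant u g ->
  pullback kap (f * g) = pullback kap f * pullback kap g.
Proof.
move=> fP gP; apply: dualext => a.
elim/(generates_ind_mul Ud0_gen_z): a f g fP gP => [|c a b IHa IHb|n a IH] f g fP gP.
- by rewrite pullbackE rmorph1 !dualME !comul1 !tev_pure /= !pullbackE rmorph1.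
- by rewrite !linearP /= IHa // IHb.
have [n2|n2] := leqP 2 n; last by rewrite Ud0_z_small // mul0r !linear0.
have zp : primitive (z n) by case: VP => _; apply.
rewrite -!ltransE ltrans_primitive_mul // !ltrans_pullback Ud0_morphismE.
rewrite (ltrans_zz_invariant UP) // linearD /= !dualDE.
by rewrite !IH //; apply: kBp_invariant_ltrans.
Qed.

Fact D0_morphism_linear : linear (fun t => pullback kap (phi (i t))).
Proof. by move=> c s t; rewrite !linearP. Qed.

Fact D0_morphism_monoid : monoid_morphism (fun t => pullback kap (phi (i t))).
Proof.
split=> [|s t].
  rewrite !rmorph1; apply: dualext => a; rewrite pullbackE !dual1E.
  elim/(generates_ind Ud0_gen_z): a => [|c a b aP bP|a b aP bP|n].
  - by rewrite !rmorph1.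
  - by rewrite !linearP /= aP bP.
  - by rewrite !rmorphM /= aP bP.
  rewrite Ud0_morphismE (counit_z UP).
  have [n2|n2] := leqP 2 n; last by rewrite Ud0_z_small // linear0.
  by rewrite counit_primitive //; case: VP => _; apply.
rewrite !rmorphM; apply: pullback_invariantM; exact: kD0_invariant.
Qed.

Definition D0_morphism : {lrmorphism D -> dual V} :=
  HB.pack (fun t => pullback kap (phi (i t)))
    (GRing.isLinear.Build _ _ _ _ _ D0_morphism_linear)
    (GRing.isMonoidMorphism.Build _ _ _ D0_morphism_monoid).

Lemma D0_morphismE t a : D0_morphism t a = phi (i t) (kap a). Proof. by []. Qed.

Definition D0_pairing := morphism_pairing D0_morphism.

Lemma D0_dual_pairing : dual_pairing D0_pairing.
Proof.
have iP : forall a : D, [/\ comul (i a) = tens_sum (fun b c => i b ⊗ i c) (comul a),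
    counit (i a) = counit a & antipode (i a) = i (antipode a)] by case: DP.
apply: morphism_dual_pairing => x.
  apply/cop_tmapE => a b; rewrite D0_morphismE rmorphM.
  have := HCM_morphism_cop UP HP (i x); move/cop_tmapE => ->.
  have [-> _ _] := iP x; rewrite tens_sum_tens_sum.
    apply: eq_tens_sum => s t; rewrite tens_sum_pure //.
    exact: (mul_bilinear (dual_eval (kap a) \o phi) (dual_eval (kap b) \o phi)).
  exact: (mul_bilinear (dual_eval (kap a) \o phi) (dual_eval (kap b) \o phi)).
by rewrite D0_morphismE rmorph1 HCM_morphism1; have [] := iP x.
Qed.


End D0Pairing.

Arguments D0_pairing : simpl never.

(** In the coproduct of [z_m] only [j = m - 1] contributes to [[X, delta_n]], because [dual_X] needs
    exactly one factor [be]. Its binomial [m] times the inductive value [(m - 1)!] gives [m!]. *)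
Lemma dual_delta_zz (k : fieldType) (U : hopfAlg k) (u : UCM_gen -> U)
    (UP : is_UCM u) n m : (2 <= m)%N ->
  dual_delta UP n.+1 (u (UCM_z m)) = (m == n.+2)%:R * m`!%:R.
Proof.
elim: n m => [|n IHn] m m2.
  by rewrite /= dual_delta1_zz; case: eqP => [->|_]; rewrite ?mul1r ?mul0r.
rewrite [dual_delta UP _]/(⁅dual_X UP, dual_delta UP n.+1⁆) dualDE dualNE !(dualM_zz UP) //.
rewrite dual_X_zz dual_X_1 [X in _ - (_ + X)]big1 => [|j _]; last by rewrite dual_X_zz !mulr0.
rewrite mul0r mulr0 add0r addr0 subr0.
rewrite (eq_big_nat _ _ (F2 := fun j => ((m == n.+3) && (j == n.+2))%:R *
    (m`!%:R : k))); last first.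
  move=> j /andP[j2 jm]; rewrite (dual_X_al_be UP) IHn //.
  have -> : (m == n.+3) && (j == n.+2) = (m - j == 1)%N && (j == n.+2).
    have [->|_] := eqVneq j n.+2; last by rewrite !andbF.
    by rewrite !andbT; lia.
  have [mj|_] := eqVneq (m - j)%N 1%N; last by rewrite mul0r mulr0 mul0r.
  have -> : m = j.+1 by rewrite -(subnK (ltnSE jm)) mj.
  by rewrite binSn factS natrM /=; case: eqP => _ /=; ring.
have [mn|_] := eqVneq m n.+3; last by rewrite [RHS]mul0r big1 // => j _; rewrite mul0r.
rewrite mn big_nat_recr //= big_nat_recr //=.
rewrite (gtn_eqF (ltnSn n.+2)) eqxx mul0r addr0.
rewrite big_nat_cond big1 ?add0r // => j /andP[/andP[_ jn] _].
by rewrite ltn_eqF // mul0r.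
Qed.

(** * From the delta_n to the t_n *)

Section CounitDerivation.
Variables (k : fieldType) (A : algType k) (e : {lrmorphism A -> k^o}).
Variables (D : {linear A -> k^o}) (d : nat -> A).
Hypothesis DM : forall a b, D (a * b) = D a * e b + e a * D b.
Hypothesis ed : forall n, e (d n) = 0.

Lemma counit_derivation1 : D 1 = 0.
Proof.
have := DM 1 1; rewrite mulr1 rmorph1 mulr1 mul1r => /eqP.
by rewrite -[X in X == _]addr0 (inj_eq (addrI _)) => /eqP.
Qed.

Lemma counit_monomial (I : Type) (r : seq I) (F c : I -> nat) :
  e (\prod_(j <- r) d (F j) ^+ c j) = ((\sum_(j <- r) c j)%N == 0%N)%:R.
Proof.
elim: r => [|j r IHr]; first by rewrite !big_nil rmorph1.
rewrite !big_cons rmorphM rmorphXn /= IHr ed addn_eq0 expr0n.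
by rewrite [RHS]/(_ && _)%:R; case: eqP; rewrite ?mul1r ?mul0r.
Qed.

Lemma counit_derivationX n c : c != 1%N -> D (d n ^+ c) = 0.
Proof.
case: c => [|[|c]] // _; first exact: counit_derivation1.
by rewrite exprS DM rmorphXn /= ed expr0n mulr0 mul0r addr0.
Qed.

Lemma counit_derivation_monomial (I : Type) (r : seq I) (F c : I -> nat) :
  (\sum_(j <- r) c j)%N != 1%N -> D (\prod_(j <- r) d (F j) ^+ c j) = 0.
Proof.
elim: r => [|j r IHr]; first by rewrite !big_nil counit_derivation1.
rewrite !big_cons DM counit_monomial rmorphXn /= ed expr0n.
have [s0|s0 cs] := eqVneq (\sum_(j <- r) c j)%N 0%N.
  rewrite s0 addn0 => cj; rewrite counit_derivationX // mul0r add0r IHr ?mulr0 //.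
  by rewrite s0.
rewrite mulr0 add0r; have [c0|_] := eqVneq (c j) 0%N; last by rewrite mul0r.
by rewrite IHr ?mulr0 //; rewrite c0 in cs.
Qed.

(** A derivation along the counit kills 1 and every monomial of degree at least two in the [d n], so
    it sees only the linear term of [t_{n+1}]; [t_1 = 1] has none. *)
Lemma counit_derivation_t_of n :
  D (t_of d n.+1) = if n == 0%N then 0 else (n.+1%:R)^-1 * (n`!%:R^-1 * D (d n)).
Proof.
rewrite /t_of linearZ linear_sum /=.
have D0 (c : {ffun 'I_n -> 'I_n.+1}) : (\sum_j c j)%N != 1%N ->
    D ((\prod_(j < n) ((c j)`! * (j.+1)`! ^ c j)%N%:R)^-1 *:
       \prod_(j < n) d j.+1 ^+ c j) = 0.
  move=> c1; rewrite linearZ /=.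
  by rewrite (counit_derivation_monomial (fun j : 'I_n => j.+1)) ?scaler0.
case: n D0 => [|n] D0.
  by rewrite big1 ?scaler0 // => c _; rewrite D0 // big_ord0.
(* [c0] is the exponent of the linear monomial: positions are shifted by one, so [ord_max] is the
   position of [d n.+1]. *)
pose c0 : {ffun 'I_n.+1 -> 'I_n.+2} := [ffun j => if j == ord_max then inord 1 else ord0].
have c0E j : c0 j = (j == ord_max) :> nat.
  by rewrite ffunE; case: eqP => // _; rewrite inordK.
have c0w (j : 'I_n) : c0 (widen_ord (leqnSn n) j) = 0%N :> nat.
  by rewrite c0E; apply/eqP; rewrite eqb0; apply/eqP => /(congr1 val) /= E;
    have := ltn_ord j; rewrite E ltnn.
have c0m : c0 ord_max = 1%N :> nat by rewrite c0E eqxx.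
rewrite (bigD1 c0) /=; last first.
  by rewrite big_ord_recr /= c0m muln1 big1 ?add0n // => j _; rewrite c0w muln0.
(* A monomial of degree one is a single [d l], and the weight condition forces [l = n.+1]. *)
rewrite [X in _ + X]big1 => [|c /andP[/eqP wc cc0]]; last first.
  apply: D0; apply: contraNneq cc0 => /eqP /sum_nat_eq1[j [_ cj cj0]].
  apply/eqP/ffunP => l; apply: val_inj; rewrite /= c0E.
  have jm : j = ord_max.
    apply: val_inj; move: wc; rewrite (bigD1 j) //= cj muln1 big1 ?addn0; first by case.
    by move=> l' lj; rewrite cj0 ?muln0.
  by rewrite -jm; have [->|lj] := eqVneq l j; [rewrite cj | rewrite cj0].
rewrite addr0 linearZ /=; congr (_ * (_ * _)).
  rewrite big_ord_recr big1 /= => [|j _]; last by rewrite c0w muln1.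
  by rewrite c0m mul1r mul1n expn1.
congr (D _).
rewrite big_ord_recr big1 /= => [|j _]; last by rewrite c0w.
by rewrite c0m mul1r.
Qed.

End CounitDerivation.

Lemma zpow_morph (k : fieldType) (A B : algType k) (f : {lrmorphism A -> B}) a a' e :
  f (zpow a a' e) = zpow (f a) (f a') e.
Proof. by case: e => n; rewrite /= rmorphXn. Qed.

Lemma t_of_morph (k : fieldType) (A B : algType k) (f : {lrmorphism A -> B}) d n :
  f (t_of d n) = t_of (fun l => f (d l)) n.
Proof.
case: n => [|n]; rewrite ?linear0 //= linearZ linear_sum /=; congr (_ *: _).
apply: eq_bigr => c _; rewrite linearZ rmorph_prod /=; congr (_ *: _).
by apply: eq_bigr => j _; rewrite rmorphXn.
Qed.

Section Values.
Variables (k : fieldType) (U : hopfAlg k) (u : UCM_gen -> U).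
Hypothesis UP : is_UCM u.
Variables (H : hopfAlg k) (h : HCM_gen -> H).
Hypothesis HP : is_HCM h.
Variables (V : hopfAlg k) (z : nat -> V).
Hypothesis VP : is_Ud0 z.
Variables (D : hopfAlg k) (d : nat -> D) (i : {lrmorphism D -> H}).
Hypothesis DP : is_kD0 h d i.

Local Notation phi := (HCM_morphism UP HP).
Local Notation kap := (Ud0_morphism UP VP).
Local Notation p1 := (D0_pairing UP HP VP DP).

Lemma D0_pairingE a t : p1 a t = phi (i t) (kap a). Proof. by []. Qed.

Lemma kD0_counit n : counit (d n) = 0.
Proof.
case: DP => _ id _ /(_ (d n)) [_ <- _]; rewrite id.
by case: HP => _ _ [_ _ ->].
Qed.

Lemma D0_pairing_zd m n : (2 <= m)%N ->
  p1 (z m) (d n.+1) = (m == n.+2)%:R * m`!%:R.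
Proof.
move=> m2; rewrite D0_pairingE (kD0_d DP) HCM_morphismE Ud0_morphismE.
exact: dual_delta_zz.
Qed.

Lemma Ud0_primitive m : (2 <= m)%N -> primitive (z m).
Proof. by case: VP => _; apply. Qed.

(** Being primitive, [z m] acts on [k[D_0]] as a derivation along the counit. Its value [m!] on
    [delta_{m-1}] cancels the coefficient [1 / (m (m-1)!)] of [delta_{m-1}] in [t_m]. *)
Lemma D0_pairing_zt : [pchar k] =i pred0 -> forall m n, (2 <= m)%N -> (1 <= n)%N ->
  p1 (z m) (t_of d n) = (m == n)%:R.
Proof.
move=> k0 m [//|n] m2 _; have zp := Ud0_primitive m2.
have [pM _ _ p1c pc1] := D0_dual_pairing UP HP VP DP.
have pz1 t : p1 1 t = counit t by apply: pc1.
have zM s t : p1 (z m) (s * t) = p1 (z m) s * counit t + counit s * p1 (z m) t.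
  have bil := mul_bilinear (pairing_functional p1 s) (pairing_functional p1 t).
  have [L LE] := tens_lift bil.
  rewrite pM -[LHS]LE zp linearD !LE !tens_sum_pure //.
  by congr (_ * _ + _ * _); apply: pz1.
rewrite (counit_derivation_t_of (D := p1 (z m)) zM kD0_counit).
case: n => [|n]; first by rewrite /= gtn_eqF.
rewrite /= [X in _ * (_ * X)](D0_pairing_zd n m2).
have [->|_] := eqVneq m n.+2; last by rewrite mul0r !mulr0.
have nz l : (0 < l)%N -> l%:R != 0 :> k by rewrite lt0n ((pcharf0P k).1 k0).
by rewrite mul1r [(n.+2)`!]factS mulnC natrM mulKf ?nz ?fact_gt0 // mulVf ?nz.
Qed.

End Values.

(** * The pairing of k[B_+] with U(b_+) *)

Section BpPairing.
Variables (k : fieldType) (U : hopfAlg k) (u : UCM_gen -> U).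
Hypothesis UP : is_UCM u.
Variables (H : hopfAlg k) (h : HCM_gen -> H).
Hypothesis HP : is_HCM h.
Variables (B : hopfAlg k) (b : kBp_gen -> B).
Hypothesis BP : is_kBp b.
Variables (L : hopfAlg k) (x : bp_gen -> L).
Hypothesis LP : is_Ubp x.

Local Notation phi := (HCM_morphism UP HP).
Local Notation dual_X := (dual_X UP).
Local Notation dual_Y := (dual_Y UP).

Definition kBp_in_UCM (g : kBp_gen) : U :=
  match g with kBp_alpha => u UCM_alpha | kBp_alphaV => u UCM_alphaV
  | kBp_beta => u UCM_beta end.

Lemma kBp_in_UCM_rel : kBp_rel kBp_in_UCM.
Proof. by case: (UCM_relP UP). Qed.

Lemma kBp_morphism_exists :
  exists r : {lrmorphism B -> U}, forall g, r (b g) = kBp_in_UCM g.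
Proof. by case: BP => -[_ _ /(_ _ _ kBp_in_UCM_rel)]. Qed.

Definition kBp_morphism := projT1 (cid kBp_morphism_exists).
Local Notation kap := kBp_morphism.

Lemma kBp_morphismE g : kap (b g) = kBp_in_UCM g.
Proof. exact: (projT2 (cid kBp_morphism_exists)). Qed.

Definition Ubp_in_HCM (g : bp_gen) : H :=
  match g with bp_X => h HCM_X | bp_Y => h HCM_Y end.

Lemma Ubp_in_HCM_rel : Ubp_rel Ubp_in_HCM.
Proof. by case: (HCM_relP HP). Qed.

Lemma Ubp_morphism_exists :
  exists r : {lrmorphism L -> H}, forall g, r (x g) = Ubp_in_HCM g.
Proof. by case: LP => -[_ _ /(_ _ _ Ubp_in_HCM_rel)]. Qed.

Definition Ubp_morphism := projT1 (cid Ubp_morphism_exists).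
Local Notation lam := Ubp_morphism.

Lemma Ubp_morphismE g : lam (x g) = Ubp_in_HCM g.
Proof. exact: (projT2 (cid Ubp_morphism_exists)). Qed.

Lemma kBp_gen_b : generates b. Proof. by case: BP => -[]. Qed.
Lemma Ubp_gen_x : generates x. Proof. by case: LP => -[]. Qed.

Lemma comul_kBp_alphaV : comul (b kBp_alphaV) = b kBp_alphaV ⊗ b kBp_alphaV.
Proof.
by case: BP => -[[aa' a'a _] _ _] [ca _] _ _; apply: comul_inverse aa' a'a ca.
Qed.

Lemma kBp_morphism_comul a : comul (kap a) = tmap kap (comul a).
Proof.
move: a; apply: comul_generates kBp_gen_b _ => g.
case: BP => _ [ca cb] _ _; case: g; rewrite ?ca ?cb ?comul_kBp_alphaV ?linearD /=
  ?tmap_pure ?rmorph1 !kBp_morphismE /=.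
- exact: comul_alpha.
- exact: comul_alphaV.
- exact: comul_beta.
Qed.

Lemma kBp_morphism_counit a : counit (kap a) = counit a.
Proof.
elim/(generates_ind kBp_gen_b): a => [|c s t sP tP|s t sP tP|g].
- by rewrite !rmorph1.
- by rewrite !linearP /= sP tP.
- by rewrite !rmorphM /= sP tP.
case: BP => -[[aa' _ _] _ _] _ [ea eb] _.
have ea' : counit (b kBp_alphaV) = 1.
  by have := congr1 counit aa'; rewrite rmorphM /= ea mul1r rmorph1.
by case: g; rewrite kBp_morphismE ?ea ?eb ?ea' /=
  ?(counit_alpha UP) ?(counit_alphaV UP) ?(counit_beta UP).
Qed.

Fact Bp_morphism_linear : linear (fun y => pullback kap (phi (lam y))).
Proof. by move=> c s t; rewrite !linearP. Qed.

Fact Bp_morphism_monoid : monoid_morphism (fun y => pullback kap (phi (lam y))).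
Proof.
split=> [|s t]; last by rewrite !rmorphM pullbackM //; apply: kBp_morphism_comul.
rewrite !rmorph1; apply: dualext => a.
by rewrite pullbackE !dual1E kBp_morphism_counit.
Qed.

Definition Bp_morphism : {lrmorphism L -> dual B} :=
  HB.pack (fun y => pullback kap (phi (lam y)))
    (GRing.isLinear.Build _ _ _ _ _ Bp_morphism_linear)
    (GRing.isMonoidMorphism.Build _ _ _ Bp_morphism_monoid).

Lemma Bp_morphismE y a : Bp_morphism y a = phi (lam y) (kap a). Proof. by []. Qed.

Definition Bp_pairing := morphism_pairing Bp_morphism.
Local Notation p2 := Bp_pairing.

(** This removes the term [Y ⊗ delta_1] from the coproduct of [X], so that [dual_X] restricts to a
    primitive functional on [k[B_+]], as [X] in [U(b_+)] demands. *)
Lemma dual_delta1_kBp a : dual_delta1 UP (kap a) = 0.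
Proof.
elim/(generates_ind kBp_gen_b): a => [|c s t sP tP|s t sP tP|g].
- by rewrite rmorph1; apply/primitive_functional1/dual_delta1_primitive.
- by rewrite !linearP /= sP tP scaler0 addr0.
- by rewrite rmorphM dual_delta1M sP tP mul0r mulr0 addr0.
case: g; rewrite kBp_morphismE /=.
- exact: dual_delta1_al.
- exact/(primitive_functional_alV UP)/dual_delta1_al/dual_delta1_primitive.
- exact: dual_delta1_be.
Qed.

Lemma Bp_morphism_X : Bp_morphism (x bp_X) = pullback kap dual_X.
Proof. by apply: dualext => a; rewrite Bp_morphismE Ubp_morphismE HCM_morphismE. Qed.

Lemma Bp_morphism_Y : Bp_morphism (x bp_Y) = pullback kap dual_Y.
Proof. by apply: dualext => a; rewrite Bp_morphismE Ubp_morphismE HCM_morphismE. Qed.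

Lemma Bp_X_primitive : primitive_functional (pullback kap dual_X).
Proof.
apply/primitive_functionalE => s t; rewrite !pullbackE rmorphM dual_XM.
by rewrite dual_delta1_kBp mulr0 addr0 !kBp_morphism_counit.
Qed.

Lemma Bp_Y_primitive : primitive_functional (pullback kap dual_Y).
Proof.
apply/primitive_functionalE => s t; rewrite !pullbackE rmorphM dual_YM.
by rewrite !kBp_morphism_counit.
Qed.

Lemma Bp_dual_pairing : dual_pairing p2.
Proof.
apply: morphism_dual_pairing => y.
  move: y; apply: cop_tmap_generates Ubp_gen_x _ => g.
  case: LP => _ /(_ g) ->; rewrite linearD /= !tmap_pure rmorph1.
  case: g; rewrite ?Bp_morphism_X ?Bp_morphism_Y.
    rewrite [pullback kap (phi _)]Bp_morphism_X; exact: Bp_X_primitive.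
  rewrite [pullback kap (phi _)]Bp_morphism_Y; exact: Bp_Y_primitive.
rewrite Bp_morphismE rmorph1 HCM_morphism1.
elim/(generates_ind Ubp_gen_x): y => [|c s t sP tP|s t sP tP|g].
- by rewrite !rmorph1.
- by rewrite !linearP /= sP tP.
- by rewrite !rmorphM /= sP tP.
rewrite Ubp_morphismE [RHS]counit_primitive; last by case: LP => _; apply.
by case: HP => _ _ [eX eY _] _; case: g.
Qed.

End BpPairing.

Arguments Bp_pairing : simpl never.

Lemma ltrans_primitive_functional (k : fieldType) (A : hopfAlg k) (a : A)
  (f : dual A) : primitive_functional f ->
  ltrans a f = (f a : k) *: (1 : dual A) + (counit a : k) *: f.
Proof.
move/primitive_functionalE => fM; apply: dualext => c.
by rewrite ltransE fM dualDE !dualZE dual1E.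
Qed.

Lemma ltrans_grouplike_mul (k : fieldType) (A : hopfAlg k) (a : A)
  (f g : dual A) : comul a = a ⊗ a -> ltrans a (f * g) = ltrans a f * ltrans a g.
Proof. by move=> ca; rewrite ltrans_mul ca ltrans2_pure. Qed.

Section BpValues.
Variables (k : fieldType) (B : hopfAlg k) (b : kBp_gen -> B).
Hypothesis BP : is_kBp b.
Variables F G : dual B.
Hypotheses (Fp : primitive_functional F) (Gp : primitive_functional G).

Local Notation al := (b kBp_alpha).
Local Notation al' := (b kBp_alphaV).
Local Notation be := (b kBp_beta).
Hypotheses (Fal : F al = 0) (Fbe : F be = 1) (Gal : G al = 1) (Gbe : G be = 0).

Lemma kBp_alphaVr : al * al' = 1. Proof. by case: BP => -[[]]. Qed.
Lemma kBp_counit_al : counit al = 1. Proof. by case: BP => _ _ []. Qed.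
Lemma kBp_counit_be : counit be = 0. Proof. by case: BP => _ _ []. Qed.
Lemma kBp_counit_alV : counit al' = 1.
Proof.
by have := congr1 counit kBp_alphaVr; rewrite rmorphM /= kBp_counit_al mul1r rmorph1.
Qed.

Lemma kBp_comul_al : comul al = al ⊗ al. Proof. by case: BP => _ []. Qed.

Lemma kBp_comul_be : comul be = al ⊗ be + be ⊗ 1. Proof. by case: BP => _ []. Qed.

Lemma kBp_alV f : primitive_functional f -> f al' = - f al.
Proof.
move=> fp; have := primitive_functional1 fp; rewrite -kBp_alphaVr.
move/primitive_functionalE: fp => ->; rewrite kBp_counit_al kBp_counit_alV.
by rewrite mulr1 mul1r addrC => /eqP; rewrite addr_eq0 => /eqP.
Qed.

Lemma ltrans_be_mul f g :
  ltrans be (f * g) = ltrans al f * ltrans be g + ltrans be f * g.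
Proof. by rewrite ltrans_mul kBp_comul_be linearD /= !ltrans2_pure ltrans1. Qed.

(** Multiplication by [F] is dual to the derivative in [be]: translation by [be] sends [F] to 1 and
    translation by [al] fixes it. At [j = 0] the truncated predecessor is multiplied by 0. *)
Lemma kBp_X_beta g j : (F * g) (be ^+ j) = j%:R * g (be ^+ j.-1).
Proof.
elim: j g => [|j IHj] g.
  by rewrite expr0 dualME comul1 tev_pure /= (primitive_functional1 Fp) !mul0r.
rewrite exprS -ltransE ltrans_be_mul !(ltrans_primitive_functional _ Fp).
rewrite Fal Fbe kBp_counit_al kBp_counit_be !scale1r !scale0r add0r addr0 mul1r.
rewrite dualDE IHj ltransE; case: j {IHj} => [|j] /=; first by rewrite mul0r add0r mul1r.
by rewrite -exprS -[in RHS]natr1 mulrDl mul1r.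
Qed.

Lemma kBp_X_monomial g e j : (F * g) (zpow al al' e * be ^+ j) =
  j%:R * g (zpow al al' e * be ^+ j.-1).
Proof.
have step a c f : comul a = a ⊗ a -> F a = 0 -> counit a = 1 ->
    (F * f) (a * c) = (F * ltrans a f) c.
  move=> ca Fa ea; rewrite -ltransE ltrans_grouplike_mul //.
  by rewrite (ltrans_primitive_functional _ Fp) Fa ea scale0r add0r scale1r.
have al'F : F al' = 0 by rewrite kBp_alV // Fal oppr0.
have powE a n f : comul a = a ⊗ a -> F a = 0 -> counit a = 1 ->
    (F * f) (a ^+ n * be ^+ j) = j%:R * f (a ^+ n * be ^+ j.-1).
  move=> ca Fa ea; elim: n f => [|n IHn] f; first by rewrite expr0 !mul1r kBp_X_beta.
  by rewrite exprS -mulrA step // IHn ltransE mulrA.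
by case: e => n; apply: powE; rewrite ?kBp_comul_al ?(comul_kBp_alphaV BP)
  ?kBp_counit_al ?kBp_counit_alV.
Qed.

(** Multiplication by [G] is dual to the Euler operator, which has weight 1 on both [al] and [be].
    Each factor [be] contributes 1 because translation by [al] sends [G] to [1 + G]. *)
Lemma kBp_Y_beta g j : (G * g) (be ^+ j) = j%:R * g (be ^+ j).
Proof.
elim: j g => [|j IHj] g.
  by rewrite expr0 dualME comul1 tev_pure /= (primitive_functional1 Gp) !mul0r.
rewrite exprS -ltransE ltrans_be_mul !(ltrans_primitive_functional _ Gp).
rewrite Gal Gbe kBp_counit_al kBp_counit_be !scale1r !scale0r addr0 mul0r addr0.
by rewrite mulrDl mul1r dualDE IHj ltransE -[in RHS]nat1r mulrDl mul1r.
Qed.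

Lemma kBp_Y_monomial g e j : (G * g) (zpow al al' e * be ^+ j) =
  (e%:~R + j%:R) * g (zpow al al' e * be ^+ j).
Proof.
have powE a n f : comul a = a ⊗ a -> counit a = 1 ->
    (G * f) (a ^+ n * be ^+ j) = (G a * n%:R + j%:R) * f (a ^+ n * be ^+ j).
  move=> ca ea; elim: n f => [|n IHn] f.
    by rewrite expr0 !mul1r kBp_Y_beta mulr0 add0r.
  rewrite exprS -mulrA -ltransE ltrans_grouplike_mul //.
  rewrite (ltrans_primitive_functional _ Gp) ea scale1r mulrDl -scalerAl mul1r.
  by rewrite dualDE dualZE IHn ltransE -[in RHS]natr1; ring.
case: e => n /=; rewrite powE ?kBp_comul_al ?(comul_kBp_alphaV BP)
  ?kBp_counit_al ?kBp_counit_alV //; congr ((_ + _) * _).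
  by rewrite Gal mul1r.
by rewrite kBp_alV // Gal NegzE mulN1r rmorphN.
Qed.

Lemma kBp_values e j r s : (F ^+ r * G ^+ s) (zpow al al' e * be ^+ j) =
  r`!%:R * (r == j)%:R * e%:~R ^+ s.
Proof.
elim: r j => [|r IHr] j.
  rewrite expr0 mul1r mul1r; elim: s => [|s IHs].
    rewrite !expr0 mulr1 dual1E rmorphM rmorphXn /= kBp_counit_be expr0n eq_sym.
    by case: e => n; rewrite /= rmorphXn /= ?kBp_counit_al ?kBp_counit_alV expr1n mul1r.
  rewrite exprS kBp_Y_monomial IHs; case: j {IHs} => [|j]; last by rewrite /= !mul0r mulr0.
  by rewrite eqxx !mul1r addr0 -exprS.
rewrite exprS -mulrA kBp_X_monomial IHr; case: j => [|j]; first by rewrite !mul0r mulr0 mul0r.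
rewrite eqSS; case: eqP => [->|_]; last by rewrite !mulr0 !mul0r mulr0.
by rewrite factS natrM !mulr1 mulrA.
Qed.

End BpValues.

(** * Nondegeneracy *)

Section Span.
Variables (k : fieldType) (W : Type) (Y A : lmodType k) (M : W -> Y -> A).

(** Coefficients live in a space [Y], later [k], [k[B_+]] or [U(b_+)]. Labels may repeat in the list
    and the family may be dependent. *)
Definition family_span (P : pred W) (a : A) := exists2 l : seq (W * Y),
  all (fun q => P q.1) l & a = \sum_(q <- l) M q.1 q.2.

Lemma family_span_gen (P : pred W) w y : P w -> family_span P (M w y).
Proof. by move=> Pw; exists [:: (w, y)]; rewrite ?big_seq1 //= Pw. Qed.

Lemma family_spanS (P Q : pred W) a :
  (forall w, P w -> Q w) -> family_span P a -> family_span Q a.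
Proof. by move=> PQ [l lP ->]; exists l => //; apply: sub_all lP => q; apply: PQ. Qed.

Hypothesis M_linear : forall w, linear (M w).

Let ML w : {linear Y -> A} :=
  HB.pack (M w) (GRing.isLinear.Build _ _ _ _ _ (M_linear w)).

Lemma family_span0 (P : pred W) : family_span P 0.
Proof. by exists [::]; rewrite ?big_nil. Qed.

Lemma family_spanL (P : pred W) c a b :
  family_span P a -> family_span P b -> family_span P (c *: a + b).
Proof.
move=> [l lP ->] [m mP ->]; exists ([seq (q.1, c *: q.2) | q <- l] ++ m).
  by rewrite all_cat mP andbT all_map.
rewrite big_cat big_map scaler_sumr; congr (_ + _); apply: eq_bigr => q _ /=.
exact/esym/(linearZ_LR (ML q.1)).
Qed.

Lemma family_spanD (P : pred W) a b :
  family_span P a -> family_span P b -> family_span P (a + b).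
Proof. by move=> aP; rewrite -[a]scale1r; apply: family_spanL. Qed.

Lemma family_spanZ (P : pred W) c a : family_span P a -> family_span P (c *: a).
Proof. by rewrite -[c *: a]addr0 => aP; apply/family_spanL/family_span0. Qed.

Lemma family_span_sum (P : pred W) (I : eqType) (r : seq I) (Q : pred I) (F : I -> A) :
  (forall j, j \in r -> Q j -> family_span P (F j)) ->
  family_span P (\sum_(j <- r | Q j) F j).
Proof.
move=> FP; rewrite big_seq_cond.
elim/big_rec: _ => [|j a /andP[jr Qj] aP]; first exact: family_span0.
by apply: family_spanD => //; apply: FP.
Qed.

Variable R : rel W.
Hypotheses (R_refl : reflexive R) (R_sym : symmetric R) (R_trans : transitive R).

(** This stands in for linear independence: a pairing detects only the total coefficient of each
    class of labels, and when [M] is constant on classes the vanishing of these totals already gives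
    a zero sum. The induction removes the class of the first label. *)
Lemma group_sum_eq0 (P : pred W) (l : seq (W * Y)) :
  (forall w w' y, R w w' -> M w y = M w' y) ->
  (forall w w', R w w' -> P w = P w') ->
  (forall w, P w -> \sum_(q <- l | R q.1 w) q.2 = 0) ->
  \sum_(q <- l | P q.1) M q.1 q.2 = 0.
Proof.
move=> MR PR; have [n] := ubnP (size l); elim: n l => // n IHn l.
case: l => [|q0 l] ln lP; first by rewrite big_nil.
pose l' := [seq q <- q0 :: l | ~~ R q.1 q0.1].
have l'0 : \sum_(q <- l' | P q.1) M q.1 q.2 = 0.
  apply: IHn => [|w Pw].
    rewrite /l' /= R_refl /=; apply: (@leq_ltn_trans (size l)); last by rewrite -ltnS.
    by rewrite size_filter count_size.
  rewrite /l' big_filter_cond; have [wq|wq] := boolP (R w q0.1).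
    rewrite big1 // => q /andP[qq qw].
    by rewrite (R_trans qw wq) in qq.
  rewrite -[RHS](lP w Pw); apply: eq_bigl => q.
  rewrite /=; case: (boolP (R q.1 w)) => [qw|_]; last exact: andbF.
  rewrite andbT; apply: contra wq => qq.
  by apply: R_trans qq; rewrite R_sym.
move: l'0; rewrite /l' big_filter_cond => l'0.
rewrite (bigID (fun q => R q.1 q0.1)) /=.
rewrite [X in _ + X](eq_bigl (fun q => ~~ R q.1 q0.1 && P q.1)) => [|q]; last exact: andbC.
rewrite l'0 addr0; have [Pq|Pq] := boolP (P q0.1); last first.
  by rewrite big1 // => q /andP[Pq' /PR E]; rewrite -E Pq' in Pq.
rewrite (eq_bigl (fun q => R q.1 q0.1)) => [|q]; last first.
  by have [/PR ->|] := boolP (R q.1 q0.1); rewrite ?Pq ?andbF.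
rewrite (eq_bigr (fun q => M q0.1 q.2)) => [|q /MR //].
by rewrite -(linear_sum (ML q0.1)) lP // linear0.
Qed.

End Span.

Lemma family_sum_eq0 (k : fieldType) (W : eqType) (Y A : lmodType k)
    (M : W -> Y -> A) (l : seq (W * Y)) :
  (forall w, linear (M w)) -> (forall w, \sum_(q <- l | q.1 == w) q.2 = 0) ->
  \sum_(q <- l) M q.1 q.2 = 0.
Proof.
move=> ML l0; apply: (@group_sum_eq0 _ _ _ _ M ML eq_op _ _ _ xpredT l) => //.
- by move=> w v t /eqP ->.
- by move=> w v c /eqP ->.
Qed.

Lemma family_span_map (k : fieldType) (W W' : Type) (Y Y' A A' : lmodType k)
    (M : W -> Y -> A) (M' : W' -> Y' -> A') (P : pred W) (P' : pred W') (f : A -> A') :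
  (forall w, linear (M' w)) -> linear f ->
  (forall w y, P w -> family_span M' P' (f (M w y))) ->
  forall a, family_span M P a -> family_span M' P' (f a).
Proof.
move=> ML' fl fM a [l lP ->].
pose F : {linear A -> A'} := HB.pack f (GRing.isLinear.Build _ _ _ _ _ fl).
rewrite -[f _]/(F _) linear_sum; elim: l lP => [|[w y] l IHl] /= lP.
  by rewrite big_nil; apply: family_span0.
have /andP[wP {}lP] := lP.
by rewrite big_cons; apply: family_spanD => //; [apply: fM | apply: IHl].
Qed.

Lemma mull_linear (k : fieldType) (A : algType k) (x : A) : linear (fun a => x * a).
Proof. by move=> c a b; rewrite mulrDr scalerAr. Qed.

Lemma mulr_linear (k : fieldType) (A : algType k) (x : A) : linear (fun a => a * x).
Proof. by move=> c a b; rewrite mulrDl scalerAl. Qed.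

Section CharZero.
Variables (k : fieldType) (k0 : [pchar k] =i pred0).

Lemma natr_pchar0_eq0 n : (n%:R == 0 :> k) = (n == 0%N).
Proof. exact: (pcharf0P k).1. Qed.

Lemma intr_pchar0_inj : injective (fun e : int => e%:~R : k).
Proof.
move=> e e' /= /eqP; rewrite -subr_eq0 -rmorphB /= => /eqP E; apply/eqP.
rewrite -subr_eq0; case: (e - e') E => n /eqP.
  by rewrite natr_pchar0_eq0 => /eqP ->.
by rewrite NegzE rmorphN oppr_eq0 natr_pchar0_eq0.
Qed.

Lemma poly_pchar0_eq0 (p : {poly k}) : (forall n : nat, p.[n%:R] = 0) -> p = 0.
Proof.
move=> p0; apply/eqP; apply: contraT => pn0.
have := @max_poly_roots _ p [seq n%:R | n <- iota 0 (size p)] pn0.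
rewrite size_map size_iota ltnn; apply.
  by apply/allP => y /mapP[n _ ->]; rewrite /root p0.
rewrite map_inj_uniq ?iota_uniq // => n m E.
by have := @intr_pchar0_inj n m E => -[].
Qed.

End CharZero.

Lemma scale_family_linear (k : fieldType) (A : lmodType k) (a : A) :
  linear (fun c : k^o => c *: a).
Proof. by move=> c y z; rewrite scalerDl scalerA. Qed.

(** * Nondegeneracy of the pairing of k[B_+] with U(b_+) *)

Section BpNondegenerate.
Variables (k : fieldType) (k0 : [pchar k] =i pred0).
Variables (U : hopfAlg k) (u : UCM_gen -> U).
Hypothesis UP : is_UCM u.
Variables (H : hopfAlg k) (h : HCM_gen -> H).
Hypothesis HP : is_HCM h.
Variables (B : hopfAlg k) (b : kBp_gen -> B).
Hypothesis BP : is_kBp b.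
Variables (L : hopfAlg k) (x : bp_gen -> L).
Hypothesis LP : is_Ubp x.

Local Notation p2 := (Bp_pairing UP HP BP LP).
Local Notation al := (b kBp_alpha).
Local Notation al' := (b kBp_alphaV).
Local Notation be := (b kBp_beta).

Definition kBp_mon (q : int * nat) : B := zpow al al' q.1 * be ^+ q.2.
Definition Ubp_mon (q : nat * nat) : L := x bp_X ^+ q.1 * x bp_Y ^+ q.2.

Lemma Bp_pairing_values (e : int) j r s : p2 (kBp_mon (e, j)) (Ubp_mon (r, s)) =
  r`!%:R * (r == j)%:R * e%:~R ^+ s.
Proof.
rewrite -(@kBp_values _ _ _ BP (pullback (kBp_morphism UP BP) (dual_X UP))
  (pullback (kBp_morphism UP BP) (dual_Y UP))); last first.
- by rewrite pullbackE kBp_morphismE; apply: dual_Y_be.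
- by rewrite pullbackE kBp_morphismE; apply: dual_Y_al.
- by rewrite pullbackE kBp_morphismE; apply: dual_X_be.
- by rewrite pullbackE kBp_morphismE; apply: dual_X_al.
- exact: Bp_Y_primitive.
- exact: Bp_X_primitive.
rewrite [LHS]morphism_pairingE /Ubp_mon rmorphM !rmorphXn /=.
by rewrite -(Bp_morphism_X UP HP BP LP) -(Bp_morphism_Y UP HP BP LP).
Qed.

Local Notation kBp_span := (family_span (fun q (c : k^o) => c *: kBp_mon q) xpredT).
Local Notation Ubp_span := (family_span (fun q (c : k^o) => c *: Ubp_mon q) xpredT).

Lemma kBp_span_mon e j : kBp_span (kBp_mon (e, j)).
Proof. by exists [:: ((e, j), 1)]; rewrite ?big_seq1 //= scale1r. Qed.

Lemma Ubp_span_mon r s : Ubp_span (Ubp_mon (r, s)).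
Proof. by exists [:: ((r, s), 1)]; rewrite ?big_seq1 //= scale1r. Qed.

Lemma kBp_spanP a : kBp_span a.
Proof.
have [aa' a'a /eqP] : kBp_rel b by case: BP => -[].
rewrite subr_eq0 => /eqP ab.
have a'b : be * al' = al' * be.
  by rewrite -[LHS]mul1r -a'a -mulrA [al * _]mulrA ab -!mulrA aa' mulr1.
have bz e : be * zpow al al' e = zpow al al' e * be.
  have cX c n : be * c = c * be -> be * c ^+ n = c ^+ n * be.
    by move=> bc; apply: (commrX n bc).
  by case: e => n; apply: cX; rewrite ?ab ?a'b.
elim/(generates_ind_mul (kBp_gen_b BP)): a => [|c s t sP tP|g s [l _ ->]].
- by have := kBp_span_mon 0 0; rewrite /kBp_mon /= mul1r.
- by apply: family_spanL => // q; apply: scale_family_linear.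
rewrite mulr_sumr; apply: family_span_sum => [q|[[e j] c] _ _].
  exact: scale_family_linear.
rewrite -scalerAr; apply: family_spanZ; first by move=> q; apply: scale_family_linear.
rewrite /kBp_mon mulrA; case: g; rewrite /=.
- case: e => [n|[|n]] /=.
  + by rewrite -exprS; apply: (kBp_span_mon (Posz n.+1) j).
  + by rewrite expr1 aa'; apply: (kBp_span_mon 0 j).
  + by rewrite exprS mulrA aa' mul1r; apply: (kBp_span_mon (Negz n) j).
- case: e => [[|n]|n] /=.
  + by rewrite mulr1 -[al']expr1; apply: (kBp_span_mon (Negz 0) j).
  + by rewrite exprS mulrA a'a mul1r; apply: (kBp_span_mon (Posz n) j).
  + by rewrite -exprS; apply: (kBp_span_mon (Negz n.+1) j).
- by rewrite bz -mulrA -exprS; apply: kBp_span_mon.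
Qed.

Lemma Ubp_spanP y : Ubp_span y.
Proof.
have rel : Ubp_rel x by case: LP => -[].
have YX : x bp_Y * x bp_X = x bp_X * x bp_Y + x bp_X.
  by move/eqP: rel; rewrite /Ubp_rel /bracket subr_eq addrC => /eqP.
have YXn r : x bp_Y * x bp_X ^+ r = x bp_X ^+ r * x bp_Y + r%:R *: x bp_X ^+ r.
  elim: r => [|r IHr]; first by rewrite mulr1 mul1r scale0r addr0.
  rewrite exprS mulrA YX mulrDl -mulrA IHr mulrDr -scalerAr !mulrA -!exprS.
  by rewrite -addrA -[in RHS]natr1 scalerDl scale1r.
elim/(generates_ind_mul (Ubp_gen_x LP)): y => [|c s t sP tP|g s [l _ ->]].
- by have := Ubp_span_mon 0 0; rewrite /Ubp_mon /= mul1r.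
- by apply: family_spanL => // q; apply: scale_family_linear.
have sl q := @scale_family_linear k L (Ubp_mon q).
rewrite mulr_sumr; apply: family_span_sum => // -[[r s'] c] _ _.
rewrite -scalerAr; apply: family_spanZ => //.
rewrite /Ubp_mon mulrA; case: g; rewrite /=.
- by rewrite -exprS; apply: (Ubp_span_mon r.+1 s').
rewrite YXn mulrDl -mulrA -exprS addrC -scalerAl; apply: family_spanL => //.
  exact: (Ubp_span_mon r s').
exact: (Ubp_span_mon r s'.+1).
Qed.

Lemma Bp_pairing_sum_values (l : seq (int * nat * k^o)) j s :
  p2 (\sum_(q <- l) (q.2 : k) *: kBp_mon q.1) (Ubp_mon (j, s)) =
  j`!%:R * \sum_(q <- l | q.1.2 == j) (q.2 : k) * q.1.1%:~R ^+ s.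
Proof.
rewrite linear_sumlz mulr_sumr [RHS]big_mkcond; apply: eq_bigr => q _.
rewrite linearZl_LR; case: q => -[e j'] c; rewrite [p2 _ _]Bp_pairing_values /= [j' == j]eq_sym.
by case: eqP => _; rewrite ?mulr0 ?mul0r ?mulr0 // mulr1 mulrCA.
Qed.

Lemma Bp_pairing_values_sum (l : seq (nat * nat * k^o)) e j :
  p2 (kBp_mon (e, j)) (\sum_(q <- l) (q.2 : k) *: Ubp_mon q.1) =
  j`!%:R * \sum_(q <- l | q.1.1 == j) (q.2 : k) * e%:~R ^+ q.1.2.
Proof.
rewrite linear_sumr mulr_sumr [RHS]big_mkcond; apply: eq_bigr => q _.
rewrite linearZr_LR; case: q => -[r s] c; rewrite [p2 _ _]Bp_pairing_values /=.
by case: eqP => [->|_]; rewrite ?mulr0 ?mul0r ?mulr0 // mulr1 mulrCA.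
Qed.

Lemma fact_pchar0_eq0 n : (n`!%:R == 0 :> k) = false.
Proof. by rewrite natr_pchar0_eq0 // eqn0Ngt fact_gt0. Qed.

Lemma Bp_pairing_nondegenerate : nondegenerate_pairing p2.
Proof.
split=> [a a0|y y0].
  have [l _ al0] := kBp_spanP a; rewrite al0.
  apply: (@family_sum_eq0 k _ k^o B (fun q c => c *: kBp_mon q)) => [q|[e0 j0]].
    exact: scale_family_linear.
  (* For a fixed power of [be], pairing with [X^j0 Y^s] gives the [s]-th moment of the coefficients
     placed at the exponents of [al]. *)
  have mon s : \sum_(q <- l | q.1.2 == j0) (q.2 : k) * q.1.1%:~R ^+ s = 0.
    have := a0 (Ubp_mon (j0, s)); rewrite al0 Bp_pairing_sum_values => /eqP.
    by rewrite mulf_eq0 fact_pchar0_eq0 => /eqP.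
  have ev (P : {poly k}) : \sum_(q <- l | q.1.2 == j0) (q.2 : k) * P.[q.1.1%:~R] = 0.
    under eq_bigr => q _ do rewrite horner_coef mulr_sumr.
    rewrite exchange_big big1 // => s _.
    under eq_bigr => q _ do rewrite mulrCA.
    by rewrite -mulr_sumr mon mulr0.
  (* As in Lagrange interpolation, [P] vanishes at all exponents of the list except [e0], which
     isolates one coefficient. *)
  pose P := \prod_(e <- [seq q.1.1 | q <- l] | e != e0) ('X - (e%:~R)%:P) : {poly k}.
  have Pe0 : P.[e0%:~R] != 0.
    rewrite horner_prod prodf_seq_neq0; apply/allP => e _; apply/implyP => ee0.
    rewrite !hornerE subr_eq0; apply: contra ee0 => /eqP E.
    exact/eqP/esym/(intr_pchar0_inj k0).
  have Pe (e : int) : e \in [seq q.1.1 | q <- l] -> e != e0 -> P.[e%:~R] = 0.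
    move=> el ee0; rewrite /P horner_prod; apply/eqP; rewrite prodf_seq_eq0.
    by apply/hasP; exists e => //; rewrite ee0 !hornerE subrr.
  have E : \sum_(q <- l | q.1.2 == j0) (q.2 : k) * P.[q.1.1%:~R] =
      (\sum_(q <- l | q.1 == (e0, j0)) (q.2 : k)) * P.[e0%:~R].
    rewrite mulr_suml [LHS]big_mkcond [RHS]big_mkcond; apply: eq_big_seq => q ql.
    rewrite [q.1]surjective_pairing xpair_eqE andbC.
    case: eqP => //= _; have [->//|qe] := eqVneq q.1.1 e0.
    by rewrite Pe ?mulr0 //; apply: map_f.
  by apply/eqP; move/eqP: (ev P); rewrite E mulf_eq0 (negPf Pe0) orbF.
have [l _ yl0] := Ubp_spanP y; rewrite yl0.
apply: (@family_sum_eq0 k _ k^o L (fun q c => c *: Ubp_mon q)) => [q|[r0 s0]].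
  exact: scale_family_linear.
(* Pairing with [al^n be^r0] evaluates [Q] at [n], up to a factorial, so [Q] has infinitely many
   roots. *)
pose Q := \sum_(q <- l | q.1.1 == r0) (q.2 : k) *: 'X^(q.1.2) : {poly k}.
have Q0 : Q = 0.
  apply: poly_pchar0_eq0 => // n; rewrite /Q horner_sum.
  under eq_bigr => q _ do rewrite !hornerE.
  have := y0 (kBp_mon (Posz n, r0)); rewrite yl0 Bp_pairing_values_sum => /eqP.
  by rewrite mulf_eq0 fact_pchar0_eq0 => /eqP.
have := congr1 (fun P : {poly k} => P`_s0) Q0; rewrite coef0 /Q coef_sum => Q0s.
rewrite -[RHS]Q0s [LHS]big_mkcond [RHS]big_mkcond; apply: eq_bigr => -[[r s] c] _ /=.
rewrite xpair_eqE; case: eqP => //= _; rewrite coefZ coefXn eq_sym.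
by case: eqP => _; rewrite ?mulr1 ?mulr0.
Qed.

End BpNondegenerate.

(* The coproduct of a product of primitive elements is the sum over the splittings
   of the word of its factors. *)
Fixpoint splits (w : seq nat) : seq (seq nat * seq nat) :=
  if w is n :: w' then
    [seq (n :: s.1, s.2) | s <- splits w'] ++ [seq (s.1, n :: s.2) | s <- splits w']
  else [:: ([::], [::])].

Lemma splits_perm w s : s \in splits w -> perm_eq w (s.1 ++ s.2).
Proof.
elim: w s => [|n w IHw] s; first by rewrite inE => /eqP ->.
rewrite mem_cat => /orP[] /mapP[t /IHw tw ->] /=; first by rewrite perm_cons.
by rewrite perm_sym perm_catC /= perm_cons perm_catC perm_sym.
Qed.

Lemma count_splits_nil w : count (fun s => s.1 == [::]) (splits w) = 1%N.
Proof.
elim: w => // n w IHw; rewrite /= count_cat !count_map.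
rewrite (eq_count (a2 := pred0)) // count_pred0 add0n -[RHS]IHw.
exact: eq_count.
Qed.

Lemma count_splits_seq1 x w :
  count (fun s => s.1 == [:: x]) (splits w) = count_mem x w.
Proof.
elim: w => // n w IHw; rewrite /= count_cat !count_map -IHw; congr (_ + _)%N.
case: (eqVneq n x) => [->|nx] /=.
  rewrite -[RHS](count_splits_nil w); apply: eq_count => s /=.
  by rewrite eqseq_cons eqxx.
rewrite (eq_count (a2 := pred0)) ?count_pred0 // => s /=.
by rewrite eqseq_cons (negPf nx).
Qed.

(** * The pairing of words in the z_n with words in the delta_n *)

Section Words.
Variables (k : fieldType) (k0 : [pchar k] =i pred0).
Variables (U : hopfAlg k) (u : UCM_gen -> U).
Hypothesis UP : is_UCM u.
Variables (H : hopfAlg k) (h : HCM_gen -> H).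
Hypothesis HP : is_HCM h.
Variables (V : hopfAlg k) (z : nat -> V).
Hypothesis VP : is_Ud0 z.
Variables (D : hopfAlg k) (d : nat -> D) (i : {lrmorphism D -> H}).
Hypothesis DP : is_kD0 h d i.

Local Notation p1 := (D0_pairing UP HP VP DP).

(* Words are indexed from 0: the letter [n] stands for [z_{n+2}], resp. for
   [delta_{n+1}], with which it pairs. *)
Definition z_word w := \prod_(n <- w) z n.+2.
Definition d_word w := \prod_(n <- w) d n.+1.

Lemma z_word_cons n w : z_word (n :: w) = z n.+2 * z_word w.
Proof. exact: big_cons. Qed.
Lemma d_word_cons n w : d_word (n :: w) = d n.+1 * d_word w.
Proof. exact: big_cons. Qed.

Lemma dualM_z_word (f g : dual V) w : (f * g) (z_word w) =
  \sum_(s <- splits w) (f (z_word s.1) : k) * g (z_word s.2).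
Proof.
elim: w f g => [|n w IHw] f g.
  by rewrite big_seq1 /z_word big_nil dualME comul1 tev_pure.
rewrite z_word_cons -ltransE ltrans_primitive_mul; last exact: (Ud0_primitive VP).
rewrite dualDE !IHw big_cat !big_map; congr (_ + _); apply: eq_bigr => s _ /=.
  by rewrite ltransE z_word_cons.
by rewrite ltransE z_word_cons.
Qed.

Lemma D0_pairing_word_mul w s t : p1 (z_word w) (s * t) =
  \sum_(q <- splits w) p1 (z_word q.1) s * p1 (z_word q.2) t.
Proof.
by rewrite [LHS]morphism_pairingE rmorphM dualM_z_word.
Qed.

(** The product of [(n+2)!] over the letters [n] of [v], times the factorials of their
    multiplicities; the latter count the matchings of [v] with a permutation of it. *)
Fixpoint word_norm (v : seq nat) : nat :=
  if v is n :: v' then ((n.+2)`! * (count_mem n v').+1 * word_norm v')%N else 1%N.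

Lemma word_norm_gt0 v : (0 < word_norm v)%N.
Proof. by elim: v => //= n v IHv; rewrite !muln_gt0 fact_gt0 IHv. Qed.

(** When the first [delta] is split off, the empty part of a splitting is killed by the counit, and
    a part with two or more letters leaves a remainder shorter than [v], hence zero by induction.
    Only the single letter [n] remains, chosen in as many ways as it occurs in [w]. *)
Lemma D0_pairing_words w v : (size w <= size v)%N ->
  p1 (z_word w) (d_word v) = (perm_eq w v)%:R * (word_norm v)%:R.
Proof.
have [_ _ _ p1c pc1] := D0_dual_pairing UP HP VP DP.
elim: v w => [|n v IHv] w.
  case: w => // _; rewrite /z_word /d_word !big_nil pc1 rmorph1 mulr1.
  by rewrite (_ : perm_eq _ _).
move=> wv; rewrite d_word_cons D0_pairing_word_mul.
rewrite (eq_big_seq (fun q => (q.1 == [:: n])%:R *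
   ((perm_eq w (n :: v))%:R * ((n.+2)`!%:R * (word_norm v)%:R)) : k)); last first.
  move=> [s t] /splits_perm; rewrite -[(s, t).1]/s -[(s, t).2]/t => wst.
  have swt : (size s + size t = size w)%N by rewrite -size_cat (perm_size wst).
  case: s wst swt => [|m [|m' s]] wst swt.
  - by rewrite /z_word big_nil pc1 (kD0_counit HP DP) !mul0r.
  - have tv : (size t <= size v)%N by rewrite -ltnS; apply: leq_trans wv; rewrite -swt add1n.
    rewrite IHv // {1}/z_word big_seq1 D0_pairing_zd // eqSS eqSS eqseq_cons andbT.
    have [mn|_] := eqVneq m n; last by rewrite !mul0r.
    by rewrite mn (permPl wst) /= mn perm_cons !mul1r mulrCA.
  - have tv : (size t < size v)%N.
      by rewrite -ltnS; apply: leq_trans wv; rewrite -swt !addSn !ltnS leq_addl.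
    rewrite IHv ?(ltnW tv) // (_ : perm_eq t v = false).
      by rewrite mul0r mulr0 eqseq_cons andbF mul0r.
    by apply/negP => /perm_size E; rewrite E ltnn in tv.
rewrite -mulr_suml -natr_sum.
have -> : (\sum_(q <- splits w) (q.1 == [:: n]))%N = count_mem n w.
  by rewrite -count_splits_seq1 -sum1_count [RHS]big_mkcond; apply: eq_bigr => q _; case: eqP.
have [wv'|_] := boolP (perm_eq w (n :: v)); last by rewrite !mul0r mulr0.
rewrite (permP wv') /= eqxx add1n !mul1r -!natrM mulnCA mulnA.
by rewrite [(_ * _.+1)%N]mulnC.
Qed.

End Words.

(** * The filtration of U(d_0) by word length *)

Section WordFiltration.
Variables (k : fieldType) (V : hopfAlg k) (z : nat -> V).
Hypothesis VP : is_Ud0 z.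

Local Notation zw := (z_word z).
Local Notation lower N :=
  (family_span (fun w (c : k^o) => c *: zw w) (fun w : seq nat => (size w < N)%N)).

Let zl w : linear (fun c : k^o => c *: zw w) := @scale_family_linear k V (zw w).

Lemma lower_word N w : (size w < N)%N -> lower N (zw w).
Proof.
move=> wN; rewrite -[zw w]scale1r.
exact: (@family_span_gen k (seq nat) k^o V (fun w (c : k^o) => c *: zw w)).
Qed.

Lemma lowerS N N' t : (N <= N')%N -> lower N t -> lower N' t.
Proof. by move=> NN; apply: family_spanS => w /leq_trans; apply. Qed.

Lemma lower_mull N n t : lower N t -> lower N.+1 (z n.+2 * t).
Proof.
apply: family_span_map (mull_linear (z n.+2)) _ t => // w c wN.
by rewrite -scalerAr -z_word_cons; apply: family_spanZ => //; apply: lower_word.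
Qed.

Lemma z_word_cat v w : zw (v ++ w) = zw v * zw w.
Proof. exact: big_cat. Qed.

Lemma lower_mulr N w t : lower N t -> lower (N + size w) (t * zw w).
Proof.
apply: family_span_map (mulr_linear (zw w)) _ t => // v c vN.
rewrite -scalerAl -z_word_cat; apply: family_spanZ => //; apply: lower_word.
by rewrite size_cat ltn_add2r.
Qed.

(** The bracket of two letters is a multiple of one letter, so each commutation past a letter
    shortens the word by one. *)
Lemma lower_commute n w : lower (size w).+1 (z n.+2 * zw w - zw w * z n.+2).
Proof.
elim: w => [|m w IHw].
  by rewrite /z_word big_nil mulr1 mul1r subrr; apply: family_span0.
have Vrel : Ud0_rel z by case: VP => -[].
have -> : z n.+2 * zw (m :: w) - zw (m :: w) * z n.+2 =
  ((n.+2)%:R - (m.+2)%:R) *: zw ((n + m.+1)%N :: w) +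
  z m.+2 * (z n.+2 * zw w - zw w * z n.+2).
  case: Vrel => _ _ /(_ n.+2 m.+2 isT isT).
  (* Letters are shifted by two: [z_{n+2}] and [z_{m+2}] bracket into [z_{n+m+3}], which is the
     letter [n + m + 1]. *)
  have -> : (n.+2 + m.+2).-1 = (n + m.+1).+2 by rewrite !addnS !addSn.
  rewrite !z_word_cons scalerAl => <-; rewrite /bracket mulrBl mulrBr !mulrA.
  by rewrite addrA subrK.
apply: family_spanD => //; last exact: lower_mull.
by apply: family_spanZ => //; apply: lower_word.
Qed.

Lemma lower_perm v w : perm_eq v w -> lower (size v) (zw v - zw w).
Proof.
elim: v w => [|n v IHv] w vw.
  have -> : w = [::] by apply/nilP; rewrite /nilp -(perm_size vw).
  by rewrite subrr; apply: family_span0.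
have /splitPr E : n \in w by rewrite -(perm_mem vw) mem_head.
case: E vw => s t; rewrite perm_sym perm_catC /= perm_cons perm_catC perm_sym => vst.
have -> : zw (n :: v) - zw (s ++ n :: t) = z n.+2 * (zw v - zw (s ++ t)) +
    (z n.+2 * zw s - zw s * z n.+2) * zw t.
  by rewrite !z_word_cat !z_word_cons mulrBr mulrBl !mulrA addrA subrK.
apply: family_spanD => //; first exact/lower_mull/IHv.
apply: (@lowerS ((size s).+1 + size t)).
  by rewrite /= (perm_size vst) size_cat.
exact/lower_mulr/lower_commute.
Qed.

End WordFiltration.

(** * Factorization and nondegeneracy of the pairing of U_CM with H_CM *)

Section Nondegenerate.
Variables (k : fieldType) (k0 : [pchar k] =i pred0).
Variables (U : hopfAlg k) (u : UCM_gen -> U).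
Hypothesis UP : is_UCM u.
Variables (H : hopfAlg k) (h : HCM_gen -> H).
Hypothesis HP : is_HCM h.
Variables (V : hopfAlg k) (z : nat -> V).
Hypothesis VP : is_Ud0 z.
Variables (D : hopfAlg k) (d : nat -> D) (i : {lrmorphism D -> H}).
Hypothesis DP : is_kD0 h d i.
Variables (B : hopfAlg k) (b : kBp_gen -> B).
Hypothesis BP : is_kBp b.
Variables (L : hopfAlg k) (x : bp_gen -> L).
Hypothesis LP : is_Ubp x.

Local Notation phi := (HCM_morphism UP HP).
Local Notation p := (HCM_pairing UP HP).
Local Notation p1 := (D0_pairing UP HP VP DP).
Local Notation p2 := (Bp_pairing UP HP BP LP).
Local Notation kap := (Ud0_morphism UP VP).
Local Notation kap' := (kBp_morphism UP BP).
Local Notation lam := (Ubp_morphism HP LP).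
Local Notation zz n := (u (UCM_z n)).

Lemma Ubp_invariant y : d0_invariant u (phi (lam y)).
Proof.
elim/(generates_ind (Ubp_gen_x LP)): y => [|c s t sP tP|s t sP tP|g].
- by rewrite !rmorph1; apply: d0_invariant1.
- by rewrite !linearP; apply: d0_invariantL.
- by rewrite !rmorphM; apply: d0_invariantM.
rewrite Ubp_morphismE; case: g; rewrite HCM_morphismE /=.
  exact: d0_invariant_dual_X.
exact: d0_invariant_dual_Y.
Qed.

Lemma rtrans_kBp_mul xi f g : kBp_invariant u f ->
  rtrans (kap' xi) (f * g) = f * rtrans (kap' xi) g.
Proof.
move=> fP; elim/(generates_ind_mul (kBp_gen_b BP)): xi => [|c s t sP tP|e s sP].
- by rewrite rmorph1 !rtrans1.
- by rewrite linearP !rtrans_linearl sP tP mulrDr -scalerAr.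
rewrite rmorphM !rtransM sP; move: (rtrans _ g) => g'. rewrite /= kBp_morphismE.
case: fP => fa fb; case: e => /=.
- by rewrite (rtrans_al_mul UP) fa.
- by rewrite rtrans_mul (comul_alphaV UP) rtrans2_pure (kBp_invariant_alV UP).
- by rewrite (rtrans_be_mul UP) fa fb mul0r addr0.
Qed.

Lemma invariant_factor f g t xi : kBp_invariant u f -> d0_invariant u g ->
  (f * g) (kap t * kap' xi) = f (kap t) * g (kap' xi).
Proof.
move=> fP gP; rewrite -rtransE rtrans_kBp_mul // -[kap' xi]mul1r -[g _]rtransE mul1r.
(* Left and right translations commute, so absorbing [xi] into [g] keeps its invariance under
   [U(d_0)]. *)
have : d0_invariant u (rtrans (kap' xi) g).
  by move=> n n2; rewrite lrtransC gP // linear0.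
move: (rtrans _ g) => {gP}g gP.
elim/(generates_ind_mul (Ud0_gen_z VP)): t f fP => [|c s t sP tP|n s sP] f fP.
- by rewrite rmorph1 dualME comul1 tev_pure.
- by rewrite !linearP /= sP // tP // mulrDl -scalerAl.
rewrite rmorphM -!ltransE /= Ud0_morphismE.
have [n2|n2] := leqP 2 n.
  rewrite (ltrans_zz_invariant UP) // gP // mulr0 addr0.
  by rewrite sP //; apply: kBp_invariant_ltrans.
have -> : zz n = 0 by case: n n2 => [|[]] // _; [apply: UCM_z0 | apply: UCM_z1].
by rewrite !ltransE mul0r !linear0 mul0r.
Qed.

Lemma HCM_pairing_factor t xi s y :
  p (kap t * kap' xi) (i s * lam y) = p1 t s * p2 xi y.
Proof.
rewrite [LHS]morphism_pairingE rmorphM invariant_factor //.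
  exact: kD0_invariant DP s.
exact: Ubp_invariant.
Qed.


Definition UCM_mon w (a : B) : U := kap (z_word z w) * kap' a.
Definition HCM_mon w (y : L) : H := i (d_word d w) * lam y.

Lemma UCM_mon_linear w : linear (UCM_mon w).
Proof. by move=> c s t; rewrite /UCM_mon linearP mulrDr scalerAr. Qed.

Lemma HCM_mon_linear w : linear (HCM_mon w).
Proof. by move=> c s t; rewrite /HCM_mon linearP mulrDr scalerAr. Qed.

Let UML := UCM_mon_linear.
Let HML := HCM_mon_linear.

(** Commutation with [z_n] is a derivation that sends the generators of [k[B_+]] into the image of
    [k[B_+]], hence preserves that image. This allows the factors of [k[B_+]] to be collected on the
    right. *)
Lemma kBp_commute n a : (2 <= n)%N ->
  exists a', kap' a * zz n = zz n * kap' a + kap' a'.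
Proof.
move=> n2; have [mal mal' mbe] : [/\ kap' (b kBp_alpha) = u UCM_alpha,
    kap' (b kBp_alphaV) = u UCM_alphaV & kap' (b kBp_beta) = u UCM_beta].
  by rewrite !kBp_morphismE.
have kal := UCM_alpha_z UP n2; have kbe := UCM_beta_z UP n2.
elim/(generates_ind (kBp_gen_b BP)): a => [|c s t [s' sE] [t' tE]|s t [s' sE] [t' tE]|g].
- by exists 0; rewrite rmorph1 mul1r mulr1 linear0 addr0.
- exists (c *: s' + t'); rewrite !linearP /= mulrDl mulrDr -scalerAl sE tE.
  by rewrite scalerDr scalerAr addrACA.
- exists (s' * t + s * t'); rewrite !(rmorphM, linearD) /= -mulrA tE mulrDr.
  by rewrite mulrA sE mulrDl -!mulrA addrA.
case: g.
- exists (n%:R *: (b kBp_alpha * b kBp_beta ^+ n.-1)).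
  by rewrite linearZ rmorphM rmorphXn /= mal mbe.
(* The relation for [al] multiplied by its inverse on both sides. *)
- exists (- (n%:R *: (b kBp_beta ^+ n.-1 * b kBp_alphaV))).
  rewrite linearN linearZ rmorphM rmorphXn /= mal' mbe.
  have -> : zz n * u UCM_alphaV =
      u UCM_alphaV * zz n + n%:R *: (u UCM_beta ^+ n.-1 * u UCM_alphaV).
    have := congr1 (fun c => u UCM_alphaV * c * u UCM_alphaV) kal.
    rewrite mulrA (UCM_alphaVK UP) mul1r => ->; rewrite mulrDr mulrDl; congr (_ + _).
      by rewrite -!mulrA (UCM_alphaKV UP) mulr1.
    by rewrite -scalerAr -scalerAl [u UCM_alphaV * (_ * _)]mulrA (UCM_alphaVK UP) mul1r.
  by rewrite addrK.
- by exists (b kBp_beta ^+ n); rewrite rmorphXn /= mbe.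
Qed.

Lemma UCM_span a : family_span UCM_mon xpredT a.
Proof.
have spanz n c : family_span UCM_mon xpredT c -> family_span UCM_mon xpredT (zz n.+2 * c).
  apply: family_span_map (mull_linear (zz n.+2)) _ c => // w y _.
  rewrite -(Ud0_morphismE UP VP) /UCM_mon mulrA -rmorphM -z_word_cons.
  exact: (@family_span_gen _ _ _ _ UCM_mon).
have spanB w : forall s y, family_span UCM_mon xpredT (kap' s * UCM_mon w y).
  elim: w => [|n w IHw] s y.
    have -> : kap' s * UCM_mon [::] y = UCM_mon [::] (s * y).
      by rewrite /UCM_mon /z_word big_nil rmorph1 !mul1r rmorphM.
    exact: (@family_span_gen _ _ _ _ UCM_mon).
  have [s' E] := @kBp_commute n.+2 s isT.
  have -> : kap' s * UCM_mon (n :: w) y =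
      zz n.+2 * (kap' s * UCM_mon w y) + kap' s' * UCM_mon w y.
    rewrite {1}/UCM_mon z_word_cons rmorphM /= Ud0_morphismE -mulrA.
    by rewrite -/(UCM_mon w y) mulrA E mulrDl mulrA.
  by apply: family_spanD => //; apply: spanz.
have spanB' s c : family_span UCM_mon xpredT c -> family_span UCM_mon xpredT (kap' s * c).
  by apply: family_span_map (mull_linear (kap' s)) _ c => // w y _; apply: spanB.
elim/(generates_ind_mul (UCM_gen_u UP)): a => [|c s t sP tP|g s sP].
- have -> : 1 = UCM_mon [::] 1 by rewrite /UCM_mon /z_word big_nil !rmorph1 mulr1.
  exact: (@family_span_gen _ _ _ _ UCM_mon).
- exact: family_spanL.
case: g => [[|[|n]]|||].
- by rewrite (UCM_z0 UP) mul0r; apply: family_span0.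
- by rewrite (UCM_z1 UP) mul0r; apply: family_span0.
- exact: spanz.
- by have := spanB' (b kBp_alpha) s sP; rewrite kBp_morphismE.
- by have := spanB' (b kBp_alphaV) s sP; rewrite kBp_morphismE.
- by have := spanB' (b kBp_beta) s sP; rewrite kBp_morphismE.
Qed.

Lemma HCM_span y : family_span HCM_mon xpredT y.
Proof.
have [d0 rXY rXd rYd _] := HCM_relP HP.
pose hd n := h (HCM_delta n).
have spand n c : family_span HCM_mon xpredT c -> family_span HCM_mon xpredT (hd n.+1 * c).
  apply: family_span_map (mull_linear (hd n.+1)) _ c => // w s _.
  rewrite -[hd _](kD0_d DP) /HCM_mon mulrA -rmorphM -d_word_cons.
  exact: (@family_span_gen _ _ _ _ HCM_mon).
have spanL g w s : family_span HCM_mon xpredT (lam (x g) * HCM_mon w s).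
  elim: w => [|n w IHw].
    have -> : lam (x g) * HCM_mon [::] s = HCM_mon [::] (x g * s).
      by rewrite /HCM_mon /d_word big_nil rmorph1 !mul1r rmorphM.
    exact: (@family_span_gen _ _ _ _ HCM_mon).
  have -> : lam (x g) * HCM_mon (n :: w) s =
      hd n.+1 * (lam (x g) * HCM_mon w s) + ⁅lam (x g), hd n.+1⁆ * HCM_mon w s.
    rewrite {1}/HCM_mon d_word_cons rmorphM /= (kD0_d DP) -mulrA.
    by rewrite -/(HCM_mon w s) mulrBl !mulrA addrC subrK.
  apply: family_spanD => //; first exact: spand.
  have wP : family_span HCM_mon xpredT (HCM_mon w s).
    exact: (@family_span_gen _ _ _ _ HCM_mon).
  rewrite Ubp_morphismE; case: g {IHw} => /=; first by rewrite rXd //; apply: spand.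
  by rewrite rYd // -scalerAl; apply: family_spanZ => //; apply: spand.
have spanL' g c : family_span HCM_mon xpredT c -> family_span HCM_mon xpredT (lam (x g) * c).
  by apply: family_span_map (mull_linear (lam (x g))) _ c => // w s _; apply: spanL.
elim/(generates_ind_mul (HCM_gen_h HP)): y => [|c s t sP tP|g s sP].
- have -> : 1 = HCM_mon [::] 1 by rewrite /HCM_mon /d_word big_nil !rmorph1 mulr1.
  exact: (@family_span_gen _ _ _ _ HCM_mon).
- exact: family_spanL.
case: g => [||[|n]].
- by have := spanL' bp_X s sP; rewrite Ubp_morphismE.
- by have := spanL' bp_Y s sP; rewrite Ubp_morphismE.
- by rewrite d0 mul0r; apply: family_span0.
- exact: spand.
Qed.

Lemma HCM_pairing_mon w v a y :
  p (UCM_mon w a) (HCM_mon v y) = p1 (z_word z w) (d_word d v) * p2 a y.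
Proof. exact: HCM_pairing_factor. Qed.

Lemma word_norm_neq0 v : (word_norm v)%:R != 0 :> k.
Proof. by rewrite natr_pchar0_eq0 // -lt0n word_norm_gt0. Qed.

(** Descent on the word length. Against the [delta] words of maximal length only permuted words
    contribute, so the total coefficient of each permutation class at that length vanishes. The
    [z_n] commute up to shorter words, so [a] is then a combination of shorter words. *)
Lemma HCM_pairing_nondegenerate_left N a :
  family_span UCM_mon (fun w => size w < N)%N a -> (forall y, p a y = 0) -> a = 0.
Proof.
have [ndl _] := Bp_pairing_nondegenerate k0 UP HP BP LP.
elim: N a => [|N IHN] a [l lN aE] a0.
  by case: l lN aE => [|q l] // _ ->; rewrite big_nil.
have lv v : size v == N -> \sum_(q <- l | perm_eq q.1 v) q.2 = 0.
  move=> /eqP vN; apply: ndl => y.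
  have := a0 (HCM_mon v y); rewrite aE linear_sumlz.
  rewrite (eq_big_seq (fun q => if perm_eq q.1 v then (word_norm v)%:R * p2 q.2 y else 0)).
    rewrite -big_mkcond -mulr_sumr -(linear_sumlz p2) => /eqP.
    by rewrite mulf_eq0 (negPf (word_norm_neq0 v)) => /eqP.
  move=> q /(allP lN) qN; rewrite HCM_pairing_mon D0_pairing_words //.
    by case: (perm_eq _ _); rewrite ?mul1r ?mul0r.
  by rewrite vN -ltnS.
apply: IHN => //; rewrite aE (bigID (fun q => size q.1 == N)) /=.
(* Sorting picks one representative per class; subtracting this zero sum leaves differences of
   permuted words, which are shorter by [lower_perm]. *)
have zE : \sum_(q <- l | size q.1 == N) UCM_mon (sort leq q.1) q.2 = 0.
  apply: (@group_sum_eq0 k _ B U (fun w => UCM_mon (sort leq w))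
    (fun w => UML (sort leq w)) perm_eq _ _ _ (fun w => size w == N)) lv.
  - exact: perm_refl.
  - exact: perm_sym.
  - exact: perm_trans.
  - by move=> w w' c /(perm_sortP leq_total leq_trans anti_leq) ->.
  - by move=> w w' /perm_size ->.
rewrite -[X in family_span _ _ (X + _)]subr0 -[X in _ - X + _]zE -sumrB.
apply: family_spanD => //; apply: family_span_sum => // -[w c] ql /= wN; last first.
  apply: (@family_span_gen _ _ _ _ UCM_mon); have := allP lN _ ql.
  by rewrite ltnS leq_eqVlt (negPf wN).
rewrite /UCM_mon -mulrBl -linearB -(eqP wN).
have lwl : linear (fun t => kap t * kap' c).
  by move=> e s t; rewrite linearP mulrDl scalerAl.
apply: (family_span_map (f := fun t => kap t * kap' c) UML lwl) (lower_perm VP _).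
  move=> v e vN; rewrite linearZ -scalerAl; apply: family_spanZ => //.
  exact: (@family_span_gen _ _ _ _ UCM_mon).
by rewrite perm_sym; apply/permPl/perm_sort.
Qed.

Lemma d_word_perm v w : perm_eq v w -> d_word d v = d_word d w.
Proof.
have dC m n : d m.+1 * d n.+1 = d n.+1 * d m.+1.
  have [_ _ _ _ hC] := HCM_relP HP; case: DP => i_inj id _ _.
  by apply: i_inj; rewrite !rmorphM /= !id; apply/eqP; rewrite -subr_eq0; apply/eqP/hC.
elim: v w => [|n v IHv] w vw.
  by have -> : w = [::] by apply/nilP; rewrite /nilp -(perm_size vw).
have /splitPr E : n \in w by rewrite -(perm_mem vw) mem_head.
case: E vw => s t; rewrite perm_sym perm_catC /= perm_cons perm_catC perm_sym => vst.
rewrite d_word_cons (IHv _ vst) /d_word !big_cat big_cons /= !mulrA; congr (_ * _).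
by apply: commr_prod => m _; apply: dC.
Qed.

(** The triangular system is now solved from short words upwards: a [z] word of shape [v] pairs to
    zero with longer [delta] words, and the classes of shorter ones vanish by induction. Words in
    the commuting [delta_n] need no correction after a permutation. *)
Lemma HCM_pairing_nondegenerate_right y : (forall a, p a y = 0) -> y = 0.
Proof.
have [_ ndr] := Bp_pairing_nondegenerate k0 UP HP BP LP.
have [l _ yE] := HCM_span y; move=> y0.
have lv v : \sum_(q <- l | perm_eq q.1 v) q.2 = 0.
  have [N] := ubnP (size v); elim: N v => // N IHN v vN.
  apply: ndr => a; have := y0 (UCM_mon v a); rewrite yE linear_sumr.
  rewrite (bigID (fun q => size q.1 < size v)%N) /=.
  have -> : \sum_(q <- l | (size q.1 < size v)%N) p (UCM_mon v a) (HCM_mon q.1 q.2) = 0.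
    apply: (@group_sum_eq0 k _ L k^o (fun w c => p (UCM_mon v a) (HCM_mon w c))
      _ perm_eq _ _ _ (fun w => size w < size v)%N) => [w c s t||||w w' c|w w'|w wv].
    - by rewrite HML linearPr.
    - exact: perm_refl.
    - exact: perm_sym.
    - exact: perm_trans.
    - by move/d_word_perm => E; rewrite /HCM_mon E.
    - by move/perm_size => ->.
    - by apply: IHN; apply: leq_trans wv _.
  rewrite add0r (eq_bigr (fun q => if perm_eq q.1 v then (word_norm v)%:R * p2 a q.2 else 0)).
    rewrite -big_mkcondr (eq_bigl (fun q => perm_eq q.1 v)) => [|q]; last first.
      have [/perm_size ->|_] := boolP (perm_eq q.1 v); last exact: andbF.
      by rewrite ltnn.
    rewrite -mulr_sumr -(linear_sumr p2) => /eqP.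
    by rewrite mulf_eq0 (negPf (word_norm_neq0 v)) => /eqP.
  move=> q; rewrite -leqNgt => vq; rewrite [LHS]HCM_pairing_mon.
  have [qv|qv] := boolP (perm_eq q.1 v).
    by rewrite (d_word_perm qv) D0_pairing_words // perm_refl mul1r.
  by rewrite D0_pairing_words // perm_sym (negPf qv) !mul0r.
rewrite yE; apply: (@group_sum_eq0 k _ L H HCM_mon HML perm_eq _ _ _ xpredT) => //.
- exact: perm_sym.
- exact: perm_trans.
- by move=> w w' c /d_word_perm E; rewrite /HCM_mon E.
Qed.

Lemma HCM_pairing_nondegenerate : nondegenerate_pairing p.
Proof.
split; last exact: HCM_pairing_nondegenerate_right.
move=> a; have [l _ aE] := UCM_span a.
apply: (@HCM_pairing_nondegenerate_left (\max_(q <- l) size q.1).+1).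
exists l => //; apply/allP => q ql; rewrite ltnS.
by rewrite (big_rem q) //= leq_maxl.
Qed.

End Nondegenerate.

Theorem theorem3p8 (k : fieldType) (k_char0 : [pchar k] =i pred0)
    (UCM : hopfAlg k) (u : UCM_gen -> UCM) (UCM_P : is_UCM u)
    (HCM : hopfAlg k) (h : HCM_gen -> HCM) (HCM_P : is_HCM h)
    (Ud0 : hopfAlg k) (z : nat -> Ud0) (Ud0_P : is_Ud0 z)
    (kD0 : hopfAlg k) (d : nat -> kD0) (i : {lrmorphism kD0 -> HCM})
    (kD0_P : is_kD0 h d i)
    (kBp : hopfAlg k) (b : kBp_gen -> kBp) (kBp_P : is_kBp b)
    (Ubp : hopfAlg k) (x : bp_gen -> Ubp) (Ubp_P : is_Ubp x) :
  exists (p1 : {bilinear Ud0 -> kD0 -> k | *%R & *%R})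
         (p2 : {bilinear kBp -> Ubp -> k | *%R & *%R})
         (p : {bilinear UCM -> HCM -> k | *%R & *%R}),
  [/\ dual_pairing p1 /\
      (forall m n, (2 <= m)%N -> (1 <= n)%N ->
         p1 (z m) (t_of d n) = (m == n)%:R),
      dual_pairing p2 /\
      (forall (e : int) (j r s : nat),
         p2 (zpow (b kBp_alpha) (b kBp_alphaV) e * b kBp_beta ^+ j)
            (x bp_X ^+ r * x bp_Y ^+ s) =
         r`!%:R * (r == j)%:R * e%:~R ^+ s),
      dual_pairing p,
      nondegenerate_pairing p
    & forall (ms ns : seq nat) (e : int) (j r s : nat),
        all (leq 2) ms -> all (leq 1) ns ->
        p ((\prod_(m <- ms) u (UCM_z m)) *
           (zpow (u UCM_alpha) (u UCM_alphaV) e * u UCM_beta ^+ j))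
          ((\prod_(n <- ns) t_of (fun l => h (HCM_delta l)) n) *
           (h HCM_X ^+ r * h HCM_Y ^+ s)) =
        p1 (\prod_(m <- ms) z m) (\prod_(n <- ns) t_of d n) *
        p2 (zpow (b kBp_alpha) (b kBp_alphaV) e * b kBp_beta ^+ j)
           (x bp_X ^+ r * x bp_Y ^+ s)].
Proof.
exists (D0_pairing UCM_P HCM_P Ud0_P kD0_P), (Bp_pairing UCM_P HCM_P kBp_P Ubp_P),
  (HCM_pairing UCM_P HCM_P); split.
- by split; [exact: D0_dual_pairing | exact: D0_pairing_zt].
- split; first exact: Bp_dual_pairing.
  by move=> e j r s; apply: (Bp_pairing_values UCM_P HCM_P kBp_P Ubp_P).
- exact: HCM_dual_pairing.
- exact: (HCM_pairing_nondegenerate k_char0 UCM_P HCM_P Ud0_P kD0_P kBp_P Ubp_P).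
move=> ms ns e j r s _ _; rewrite -HCM_pairing_factor; congr (HCM_pairing _ _ _ _).
  rewrite rmorph_prod rmorphM rmorphXn /= zpow_morph !kBp_morphismE; congr (_ * _).
  by apply: eq_bigr => m _; rewrite Ud0_morphismE.
rewrite rmorph_prod rmorphM !rmorphXn /= !Ubp_morphismE; congr (_ * _).
apply: eq_bigr => n _; rewrite t_of_morph; congr (t_of _ n).
by apply: funext => l; rewrite (kD0_d kD0_P).
Qed.
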